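(* For $\mathcal L_2$-almost every $\lambda\in\mathcal M\cap B_{1/\sqrt2}(0)$ we have $\dim_H(A_\lambda)=s(\lambda)$. Moreover, for any $0<r<R<1/\sqrt2$, $$\dim_H\{\lambda\in\mathcal M:\ r<|\lambda|<R,\ \dim_H A_\lambda<s(\lambda)\}\le\frac{\log2}{-\log R}<2.$$
   Context: $\mathcal L_2$ is Lebesgue (area) measure on $\mathbb C$; $B_r(0)$ is the open disc of radius $r$ about $0$. $A_\lambda=\{\sum_{n\ge0}a_n\lambda^n:a_n\in\{-1,1\}\}$ and $\mathcal M=\{\lambda\in\mathbb D:\ \exists (a_k)_{k\ge1},\ a_k\in\{-1,0,1\},\ 1+\sum_{k\ge1}a_k\lambda^k=0\}$ (the set of $\lambda$ in the unit disc $\mathbb D$ with $A_\lambda$ connected). $s(\lambda)=\frac{\log2}{-\log|\lambda|}$ is the similarity dimension. $\dim_H$ is Hausdorff dimension. *)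

(* Defs.v *)
From HB Require Import structures.
From mathcomp Require Import all_boot all_order all_algebra.
From mathcomp Require Import all_classical all_reals all_analysis.
Set Implicit Arguments. Unset Strict Implicit. Unset Printing Implicit Defensive.
Import Order.TTheory GRing.Theory Num.Theory numFieldNormedType.Exports.
Local Open Scope classical_set_scope.
Local Open Scope ring_scope.

Section Defs.
Variable R : realType.

Definition cpx := (R * R)%type.

Definition cadd (z w : cpx) : cpx := (z.1 + w.1, z.2 + w.2).
Definition csub (z w : cpx) : cpx := (z.1 - w.1, z.2 - w.2).
Definition cmul (z w : cpx) : cpx :=
  (z.1 * w.1 - z.2 * w.2, z.1 * w.2 + z.2 * w.1).
Definition cscale (a : R) (z : cpx) : cpx := (a * z.1, a * z.2).
Fixpoint cexp (z : cpx) (n : nat) : cpx :=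
  if n is n'.+1 then cmul (cexp z n') z else (1, 0).

Definition cabs (z : cpx) : R := Num.sqrt (z.1 ^+ 2 + z.2 ^+ 2).

Definition cseries_to (u : nat -> cpx) (z : cpx) : Prop :=
  ((fun n => \sum_(i < n) (u i).1) @ \oo --> z.1) /\
  ((fun n => \sum_(i < n) (u i).2) @ \oo --> z.2).

Definition Aset (lam : cpx) : set cpx :=
  [set z | exists a : nat -> bool,
     cseries_to (fun n => cscale (if a n then 1 else -1) (cexp lam n)) z].

Definition Mset : set cpx :=
  [set lam | cabs lam < 1 /\
     exists a : nat -> int, (forall k, (a k == 0) || (a k == 1) || (a k == -1)) /\
       cseries_to (fun n => if n is 0 then (1, 0)
                            else cscale (a n)%:~R (cexp lam n)) (0, 0)].

Definition simdim (lam : cpx) : R := ln 2 / (- ln (cabs lam)).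

Local Open Scope ereal_scope.

(* diameter (Euclidean), with diam set0 = 0 *)
Definition diam (A : set cpx) : \bar R :=
  ereal_sup ([set 0] `|` [set (cabs (csub x y))%:E | x in A & y in A]).

Definition hcontent (s delta : R) (E : set cpx) : \bar R :=
  ereal_inf [set \sum_(0 <= i <oo)
                 (if U i == set0 then 0 else (powR (fine (diam (U i))) s)%:E)
            | U in [set U : nat -> set cpx |
                     E `<=` \bigcup_i U i /\ forall i, diam (U i) <= delta%:E]].

Definition hmeasure (s : R) (E : set cpx) : \bar R :=
  ereal_sup [set hcontent s delta E | delta in [set delta : R | (0 < delta)%R]].

Definition hdim (E : set cpx) : \bar R :=
  ereal_inf [set s%:E | s in [set s : R | (0 <= s)%R /\ hmeasure s E = 0]].

Definition leb2 : set cpx -> \bar R :=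
  (@lebesgue_measure R \x @lebesgue_measure R).

End Defs.

(* Main.v *)
(** By Jensen's formula a real polynomial with coefficients in [-1,1] and constant
    term 1 has no nonreal double zero of modulus less than 2 * 5^(-5/8), which is more
    than 1/sqrt 2: the double zero and its conjugate count for four zeros.  In
    quantitative form, the parameters in a fixed region off the real axis for which two
    given words with first difference at [k] have points closer than [e] form a set of
    diameter O(e / |lam|^k).  Hence, outside a set of Hausdorff dimension at most the
    similarity dimension at radius R (a limsup set, covered scale by scale with a maximal
    separated set), the number of pairs of words with close points is nearly minimal at
    all small scales, and this forces dim A_lam = s(lam).  Real parameters form a set of
    dimension at most 1, which is harmless: M lies outside the disc of radius 1/2,
    so R > 1/2 and the bound log 2 / (- log R) is at least 1. *)

Require Import Defs.
From HB Require Import structures.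
From mathcomp Require Import all_boot all_order all_algebra.
From mathcomp Require Import all_classical all_reals all_analysis.
From mathcomp Require Import complex.
From mathcomp Require Import ring lra zify.
Set Implicit Arguments. Unset Strict Implicit. Unset Printing Implicit Defensive.
Import Order.TTheory GRing.Theory Num.Theory numFieldNormedType.Exports.
Import ComplexField.Normc.
Local Open Scope classical_set_scope.
Local Open Scope complex_scope.
Local Open Scope ring_scope.

(** * Near-double zeros off the real axis: quantitative transversality *)

Section Transversality.
Variable R : realType.
Implicit Types (a c n rho eta dl : R) (f g h : {poly R}) (z w : R[i]).

(** Let q bound |lam| from below. At scale q^(L j), lam is bad if, for some k, the pairs of words
    that first differ at k and have close points have probability above 2^(-L j). With n = L j - k,
    at most 2^n well separated parameters are bad for k, each standing for a ball of radius of order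
    q^n. At exponent s this costs about (2 q^s)^n, which is summable once q^s < 1/2; since q < R,
    one s above the similarity dimension at radius R serves every q. For n to grow with j, only k <
    (L - 1) j is tested. Pairs that agree longer are all counted as close, which loses a factor 2^j;
    if t is below the similarity dimension at radius q, then 2 q^t > 1, and a large L absorbs this
    loss. Probabilities are averages over finite words, so no measure on A_lam and no energy
    integral appears. *)

Definition quad c0 c1 c2 : {poly R} := c2 *: 'X^2 + c1 *: 'X + c0%:P.

Lemma coef_quad c0 c1 c2 i : (quad c0 c1 c2)`_i =
  c2 *+ (i == 2%N) + c1 *+ (i == 1%N) + c0 *+ (i == 0%N).
Proof.
rewrite /quad !coefD !coefZ coefXn coefX coefC.
by case: i => [|[|[|i]]]; rewrite /= ?mulr1 ?mulr0 ?mulr1n ?mulr0n ?addr0 ?add0r.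
Qed.

Lemma coef_quadM c0 c1 c2 g i : (quad c0 c1 c2 * g)`_i =
  c0 * g`_i + (if i is j.+1 then c1 * g`_j else 0)
            + (if i is j.+2 then c2 * g`_j else 0).
Proof.
rewrite /quad !mulrDl !coefD -!scalerAl !coefZ mul_polyC coefZ coefXnM coefXM.
by case: i => [|[|i]]; rewrite /= ?subn2 /=; ring.
Qed.

(** By Parseval this is the mean of |g|^2 over the circle of squared radius [rho], once [m] is at
    least the size of [g]. It replaces the integral in Jensen's formula. *)
Definition wnorm rho m g := \sum_(i < m) g`_i ^+ 2 * rho ^+ i.

(* The identity [N (p g) = N (p* g)], with [p*] the reversal of [p] in the circle
   of squared radius [rho]: the Blaschke factor [p / p*] is an isometry. *)
Lemma wnorm_reverse rho c n g m : rho != 0 -> (size g <= m)%N ->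
  wnorm rho m.+2 (quad n c 1 * g) = wnorm rho m.+2 (quad rho c (n / rho) * g).
Proof.
move=> rho0 gm.
(* The truncated sums differ only by a boundary term in the coefficients of [g] at k and k + 1,
   which vanish at k = m. *)
suff H k : wnorm rho k.+2 (quad n c 1 * g) -
    wnorm rho k.+2 (quad rho c (n / rho) * g) =
    (n ^+ 2 - rho ^+ 2) * (g`_k.+1 ^+ 2 * rho ^+ k.+1 + g`_k ^+ 2 * rho ^+ k)
    + c * (n - rho) * g`_k * g`_k.+1 * rho ^+ k.+1 *+ 2.
  apply/eqP; rewrite -subr_eq0 H.
  have g0 : g`_m = 0 by rewrite nth_default.
  have g1 : g`_m.+1 = 0 by rewrite nth_default // ltnW.
  by rewrite g0 g1; apply/eqP; ring.
elim: k => [|k IH].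
  rewrite /wnorm !big_ord_recl !big_ord0 /= !coef_quadM /bump /=.
  by field.
rewrite /wnorm !(big_ord_recr k.+2) /= -!/(wnorm _ _ _).
rewrite opprD addrACA IH !coef_quadM !exprS.
by field.
Qed.

Lemma term_le_wnorm rho m g i : 0 < rho -> (i < m)%N -> g`_i ^+ 2 * rho ^+ i <= wnorm rho m g.
Proof.
move=> rho0 im; rewrite /wnorm (bigD1 (Ordinal im)) //= lerDl.
by apply: sumr_ge0 => j _; rewrite mulr_ge0 ?sqr_ge0 ?exprn_ge0 // ltW.
Qed.

Lemma size_quadM c0 c1 c2 g m : (size g <= m)%N -> (size (quad c0 c1 c2 * g)%R <= m.+2)%N.
Proof.
move=> gm; apply/leq_sizeP => j mj; rewrite coef_quadM.
case: j mj => [|[|j]] // mj.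
have {}mj : (m <= j)%N by [].
have g0 i : (j <= i)%N -> g`_i = 0.
  by move=> ji; rewrite nth_default //; apply: leq_trans gm (leq_trans mj ji).
by rewrite !g0 ?mulr0 ?addr0 //; lia.
Qed.

(** Reversing both quadratic factors turns their constant terms into [rho], so the constant
    coefficient becomes rho^2 times that of [g]; its square is one term of the norm. *)
Lemma wnorm_lb rho c c' n n' g m : 0 < rho -> (size g <= m)%N ->
  rho ^+ 4 * g`_0 ^+ 2 <= wnorm rho m.+4 (quad n c 1 * (quad n' c' 1 * g)).
Proof.
move=> rho0 gm; have rhoN0 : rho != 0 by rewrite gt_eqF.
rewrite wnorm_reverse ?size_quadM // [quad rho _ _ * _]mulrCA wnorm_reverse ?size_quadM //.
apply: le_trans (term_le_wnorm (i := 0) _ _ _) => //.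
rewrite !coef_quadM !addr0 expr0; by rewrite le_eqVlt; apply/orP; left; apply/eqP; ring.
Qed.

Definition ceval f z := (map_poly (real_complex R) f).[z].

Lemma cevalMD f g h z : ceval (f * g + h) z = ceval f z * ceval g z + ceval h z.
Proof. by rewrite /ceval rmorphD rmorphM hornerD hornerM. Qed.

Definition minquad z := quad (complex.Re z ^+ 2 + complex.Im z ^+ 2) (- (2 * complex.Re z)) 1.

Lemma ceval_quad c0 c1 c2 z :
  ceval (quad c0 c1 c2) z = c2%:C * z ^+ 2 + c1%:C * z + c0%:C.
Proof.
by rewrite /ceval /quad !rmorphD /= !map_polyZ /= map_polyXn map_polyX map_polyC !hornerE.
Qed.

Lemma ceval_minquad z w : ceval (minquad z) w = (w - z) * (w - z^*)%C.
Proof.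
rewrite ceval_quad; case: z w => [a b] [c d]; apply/eqP; rewrite eq_complex /=.
by apply/andP; split; apply/eqP; ring.
Qed.

Lemma ceval_minquad_root z : ceval (minquad z) z = 0.
Proof. by rewrite ceval_minquad subrr mul0r. Qed.

Lemma ge_normc_Re z : `|complex.Re z| <= normc z.
Proof.
by case: z => a b /=; rewrite -sqrtr_sqr ler_wsqrtr // lerDl sqr_ge0.
Qed.

Lemma ge_normc_Im z : `|complex.Im z| <= normc z.
Proof.
by case: z => a b /=; rewrite -sqrtr_sqr ler_wsqrtr // lerDr sqr_ge0.
Qed.

Lemma normc_ge0 z : 0 <= normc z.
Proof. by apply: le_trans (ge_normc_Re z). Qed.

Lemma normc_sqr z : normc z ^+ 2 = complex.Re z ^+ 2 + complex.Im z ^+ 2.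
Proof. by case: z => a b /=; rewrite sqr_sqrtr // addr_ge0 ?sqr_ge0. Qed.

Lemma normc_real c : normc c%:C = `|c|.
Proof. by rewrite /= expr0n addr0 sqrtr_sqr. Qed.

(** The remainder of f modulo [minquad z] takes the value f(z) at z. Its imaginary part there is c1
    Im z, which controls c1 because z is off the real axis; the real part then controls c0. *)
Lemma minquad_division f z eta dl : 0 < eta -> eta <= `|complex.Im z| -> `|complex.Re z| <= 1 ->
  normc (ceval f z) <= dl ->
  exists g c0 c1, [/\ f = minquad z * g + quad c0 c1 0,
    `|c1| <= dl / eta & `|c0| <= dl + dl / eta].
Proof.
move=> eta0 etaz rez fz.
have sq : size (minquad z) = 3%N.
  apply/eqP; rewrite eqn_leq; apply/andP; split.
    by apply/leq_sizeP => -[|[|[|j]]] // _; rewrite coef_quad /= !mulr0n !addr0.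
  rewrite ltnNge; apply/negP => /leq_sizeP /(_ 2%N (leqnn _)) /eqP.
  by rewrite coef_quad /= mulr1n !mulr0n !addr0 oner_eq0.
have q0 : minquad z != 0 by rewrite -size_poly_eq0 sq.
pose r := f %% minquad z.
have sr : (size r < 3)%N by rewrite -sq ltn_modp.
have rE : r = quad r`_0 r`_1 0.
  apply/polyP => -[|[|i]]; rewrite coef_quad /= ?mulr0n ?mulr1n ?addr0 ?add0r //.
  by rewrite mul0rn ?addr0 nth_default //; exact: (@leq_trans 2).
have fE : f = minquad z * (f %/ minquad z) + quad r`_0 r`_1 0.
  by rewrite -rE mulrC -divp_eq.
exists (f %/ minquad z), r`_0, r`_1; split => //.
all: have ez : ceval f z = (r`_1)%:C * z + (r`_0)%:C.
1,3: rewrite {1}fE cevalMD.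
1,2: by rewrite ceval_minquad_root mul0r add0r ceval_quad mul0r add0r.
all: have c1 : `|r`_1| <= dl / eta.
1,3: rewrite ler_pdivlMr //; apply: le_trans fz; apply: le_trans (ge_normc_Im _).
1,2: rewrite ez; case: (z) etaz => a b /= etaz.
1,2: have -> : r`_1 * b + 0 * a + 0 = r`_1 * b by ring.
1,2: by rewrite normrM ler_wpM2l.
  by [].
have -> : r`_0 = complex.Re (ceval f z) - r`_1 * complex.Re z.
  by rewrite ez; case: (z) => a b /=; ring.
apply: le_trans (ler_normB _ _) _; apply: lerD.
  exact: le_trans (ge_normc_Re _) fz.
by rewrite normrM; apply: le_trans c1; rewrite ler_piMr.
Qed.

(** The value 4/5 maximises rho^4 (1 - rho), the quantity that decides between the lower bound
    [wnorm_lb] and the sum 1 / (1 - rho) of the weights. *)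
Lemma wnorm_le c f m : 0 <= c -> (forall i, `|f`_i| <= c) -> wnorm (4 / 5) m f <= 5 * c ^+ 2.
Proof.
move=> c0 fc; apply: (@le_trans _ _ (c ^+ 2 * \sum_(i < m) (4 / 5) ^+ i)).
  rewrite mulr_sumr /wnorm; apply: ler_sum => i _.
  rewrite ler_wpM2r ?exprn_ge0 //.
  by rewrite -real_normK ?num_real // ler_sqr ?nnegrE.
have -> : \sum_(i < m) (4 / 5 : R) ^+ i = 5 - 5 * (4 / 5) ^+ m.
  elim: m => [|m IH]; first by rewrite big_ord0 expr0; ring.
  by rewrite big_ord_recr /= IH exprS; field.
have : 0 <= c ^+ 2 * (4 / 5) ^+ m.
  by rewrite mulr_ge0 ?sqr_ge0 ?exprn_ge0.
by rewrite mulrBr; lra.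
Qed.

Lemma coef_linear_le c0 c1 B i : 0 <= B -> `|c0| <= B -> `|c1| <= B ->
  `|(quad c0 c1 0)`_i| <= B.
Proof.
move=> B0 h0 h1; rewrite coef_quad.
by case: i => [|[|[|i]]]; rewrite /= ?mulr0n ?mulr1n ?addr0 ?add0r ?normr0.
Qed.

Lemma ceval_poly (b : nat -> R) m z :
  ceval (\poly_(i < m) b i) z = \sum_(i < m) (b i)%:C * z ^+ i.
Proof.
rewrite /ceval poly_def rmorph_sum horner_sum; apply: eq_bigr => i _ /=.
by rewrite map_polyZ map_polyXn !hornerE.
Qed.

(* A [-1,1]-polynomial that is nearly 0 at two close nonreal points is close to a
   multiple of [minquad z * minquad w], of value at most 1/4 at 0; by [wnorm_lb]
   this is too small a value for a norm of at most sqrt 5. *)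
Lemma transversality eta : 0 < eta -> exists2 C, 0 < C &
  forall (b : nat -> R) m z w dl, (forall i, `|b i| <= 1) -> `|b 0%N| = 1 ->
    normc z ^+ 2 <= 1 / 2 -> normc w ^+ 2 <= 1 / 2 ->
    eta <= `|complex.Im z| -> eta <= `|complex.Im w| -> 0 < complex.Im z * complex.Im w ->
    normc (\sum_(i < m.+1) (b i)%:C * z ^+ i) <= dl ->
    normc (\sum_(i < m.+1) (b i)%:C * w ^+ i) <= dl ->
    normc (w - z) <= C * dl.
Proof.
move=> eta0; pose e := eta^-1; have e0 : 0 < e by rewrite invr_gt0.
(* If z and w are at distance D <= 2, the two divisions below leave an error with coefficients at
   most K dl / D. The factor 20 brings it below 1/20. *)
pose K := 8 * e * (1 + e) ^+ 2 + 2 * (1 + e).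
have K0 : 0 < K.
  by rewrite /K addr_gt0 ?mulr_gt0 ?exprn_gt0 //; lra.
exists (20 * K); first lra.
move=> b m z w dl b1 b01 z1 w1 etaz etaw zw fz fw.
have normc_le1 (x : R[i]) : normc x ^+ 2 <= 1 / 2 -> normc x <= 1.
  move=> h; rewrite -(@ler_pXn2r _ 2) ?nnegrE ?normc_ge0 // expr1n.
  by apply: le_trans h _; lra.
set D := normc (w - z).
have D0 : 0 <= D by exact: normc_ge0.
have dl0 : 0 <= dl by apply: le_trans fz; exact: normc_ge0.
have D2 : D <= 2.
  apply: le_trans (le_normcD _ _) _; rewrite normcN.
  by rewrite (_ : 2 = 1 + 1 :> R) // lerD // normc_le1.
rewrite leNgt; apply/negP => DC.
have {}D0 : 0 < D by apply: le_lt_trans DC; rewrite mulr_ge0 //; lra.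
have dlD : dl / D <= (20 * K)^-1.
  by rewrite ler_pdivrMr // ler_pdivlMl ?(ltW DC) //; lra.
rewrite -!ceval_poly in fz fw; set f := \poly_(i < m.+1) b i in fz fw.
have Re1 (x : R[i]) : normc x ^+ 2 <= 1 / 2 -> `|complex.Re x| <= 1.
  by move=> /normc_le1 h; apply: le_trans (ge_normc_Re _) h.
have [g [c0 [c1 [fE hc1 hc0]]]] := minquad_division eta0 etaz (Re1 _ z1) fz.
rewrite -/e in hc1 hc0.
(* The value f(w) minus the first remainder at w is g(w) times (w - z) and (w - conj z). These have
   modulus D and at least [eta], the latter because z and w lie on the same side of the real
   axis. *)
pose gam := dl * (2 + 2 * e) * e / D.
have gw : normc (ceval g w) <= gam.
  rewrite /gam ler_pdivlMr // {2}/e ler_pdivlMr //.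
  have h1 : normc (ceval (minquad z) w * ceval g w) <= dl * (2 + 2 * e).
    have -> : ceval (minquad z) w * ceval g w = ceval f w - (c1%:C * w + c0%:C).
      by rewrite fE cevalMD ceval_quad mul0r add0r addrK.
    apply: le_trans (le_normcD _ _) _; rewrite normcN.
    have : normc (c1%:C * w + c0%:C) <= `|c1| * normc w + `|c0|.
      by apply: le_trans (le_normcD _ _) _; rewrite normcM !normc_real.
    have : `|c1| * normc w <= `|c1| by rewrite ler_piMr // normc_le1.
    by move: fw hc1 hc0; set x := normc _; set y := normc _; lra.
  rewrite ceval_minquad !normcM -/D in h1; apply: le_trans h1.
  rewrite [leLHS](_ : _ = D * eta * normc (ceval g w)); last by ring.
  rewrite ler_wpM2r ?normc_ge0 // ler_wpM2l ?(ltW D0) //.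
  apply: le_trans (ge_normc_Im _).
  have -> : complex.Im (w - z^*) = complex.Im w + complex.Im z.
    by case: (w) (z) => ? ? [? ?] /=; rewrite opprK.
  apply: (le_trans etaz); rewrite -ler_sqr ?nnegrE // !real_normK ?num_real //.
  by move: zw; nra.
have [g2 [d0 [d1 [gE hd1 hd0]]]] := minquad_division eta0 etaw (Re1 _ w1) gw.
rewrite -/e in hd1 hd0.
pose err := minquad z * quad d0 d1 0 + quad c0 c1 0.
have hE : f - err = minquad z * (minquad w * g2) by rewrite fE gE /err; ring.
have gam0 : 0 <= gam by apply: le_trans gw; exact: normc_ge0.
pose B2 := gam * (1 + e); pose B1 := dl * (1 + e).
have game : 0 <= gam * e by rewrite mulr_ge0 // ltW.
have dle : 0 <= dl * e by rewrite mulr_ge0 // ltW.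
have B20 : 0 <= B2 by rewrite /B2 mulrDr mulr1 addr_ge0.
have B10 : 0 <= B1 by rewrite /B1 mulrDr mulr1 addr_ge0.
have kap : 4 * B2 + B1 <= 20^-1.
  have -> : 4 * B2 = dl / D * (8 * e * (1 + e) ^+ 2) by rewrite /B2 /gam; field; rewrite gt_eqF.
  have B1le : B1 <= dl / D * (2 * (1 + e)).
    rewrite [leRHS](_ : _ = B1 * (2 / D)); last by rewrite /B1; field; rewrite gt_eqF.
    by rewrite ler_peMr // ler_pdivlMr // mul1r.
  apply: (@le_trans _ _ (dl / D * K)); first by rewrite /K mulrDr lerD2l.
  apply: (@le_trans _ _ ((20 * K)^-1 * K)); first by rewrite ler_wpM2r // ltW.
  by rewrite invfM mulfVK // gt_eqF.
have errb i : `|err`_i| <= 20^-1.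
  apply: le_trans kap; rewrite coefD coef_quadM.
  have r2 j : `|(quad d0 d1 0)`_j| <= B2.
    by apply: coef_linear_le => //; rewrite /B2; lra.
  have r1 j : `|(quad c0 c1 0)`_j| <= B1.
    by apply: coef_linear_le => //; rewrite /B1; lra.
  apply: le_trans (ler_normD _ _) _; apply: lerD => //.
  (* The coefficients of [minquad z] are at most 1, 2 and 1 in modulus. *)
  rewrite (_ : 4 * B2 = B2 + 2 * B2 + B2); last by ring.
  apply: le_trans (ler_normD _ _) _; apply: lerD => //; last first.
    by case: i => [|[|i]]; rewrite ?normr0 // mul1r.
  apply: le_trans (ler_normD _ _) _; apply: lerD => //.
    rewrite -normc_sqr normrM -[leRHS]mul1r ler_pM //.
    by rewrite ger0_norm ?sqr_ge0 //; lra.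
  case: i => [|i]; first by rewrite normr0 mulr_ge0.
  rewrite normrM ler_pM //.
  by rewrite normrN normrM ger0_norm // ler_piMr // Re1.
have := @wnorm_lb (4 / 5) (- (2 * complex.Re z)) (- (2 * complex.Re w))
  (complex.Re z ^+ 2 + complex.Im z ^+ 2) (complex.Re w ^+ 2 + complex.Im w ^+ 2)
  g2 (size g2) _ (leqnn _).
rewrite -!/(minquad _) -hE => /(_ ltac:(lra)) lb.
have ub : wnorm (4 / 5) (size g2).+4 (f - err) <= 5 * (21 / 20) ^+ 2.
  apply: wnorm_le => [|i]; first lra.
  rewrite coefB; apply: le_trans (ler_normB _ _) _.
  rewrite (_ : 21 / 20 = 1 + 20^-1); last by field.
  by rewrite lerD // coef_poly; case: ifP; rewrite ?normr0.
have val0 : (f - err)`_0 = normc z ^+ 2 * (normc w ^+ 2 * g2`_0).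
  by rewrite hE !coef_quadM !addr0 -!normc_sqr.
have lb0 : 19 / 20 <= `|(f - err)`_0|.
  rewrite coefB; apply: le_trans (lerB_dist _ _).
  have -> : `|f`_0| = 1 by rewrite coef_poly.
  by have := errb 0%N; lra.
have {lb0} : (19 / 20) ^+ 2 <= (1 / 4) ^+ 2 * g2`_0 ^+ 2.
  apply: (@le_trans _ _ (`|(f - err)`_0| ^+ 2)).
    by rewrite ler_sqr ?nnegrE //; lra.
  rewrite real_normK ?num_real // val0 mulrA exprMn ler_wpM2r ?sqr_ge0 //.
  rewrite ler_sqr ?nnegrE ?mulr_ge0 ?normc_ge0 ?sqr_ge0 //.
  rewrite (_ : 1 / 4 = 1 / 2 * (1 / 2)); last by field.
  by rewrite ler_pM ?sqr_ge0.
(* The lower bound is at least (4/5)^4 16 (19/20)^2, about 5.91, against the upper bound 5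
   (21/20)^2, about 5.51. *)
by move: (le_trans lb ub); lra.
Qed.
End Transversality.

(** * Random binary words, and compactness of the space of infinite words *)

Section Average.
Variable R : realType.
Implicit Types (f g : (nat -> bool) -> R) (u v : nat -> bool).

Definition scons (b : bool) u : nat -> bool := fun n => if n is m.+1 then u m else b.

(* Expectation of [f] when the first [n] digits are fair coin tosses and the other
   ones are [true]. *)
Fixpoint avg (n : nat) f : R :=
  if n is m.+1 then
    (avg m (fun u => f (scons true u)) + avg m (fun u => f (scons false u))) / 2
  else f (fun=> true).

Lemma ler_avg n f g : (forall u, f u <= g u) -> avg n f <= avg n g.
Proof.
elim: n f g => [|n IH] f g fg /=; first exact: fg.
by rewrite ler_pM2r ?invr_gt0 // lerD // IH.
Qed.

Lemma eq_avg n f g : f =1 g -> avg n f = avg n g.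
Proof. by move=> /funext ->. Qed.

Lemma avg_cst n (c : R) : avg n (fun=> c) = c.
Proof. by elim: n => [|n IH] //=; rewrite IH; field. Qed.

Lemma avg_ge0 n f : (forall u, 0 <= f u) -> 0 <= avg n f.
Proof. by move=> f0; rewrite -(avg_cst n 0); exact: ler_avg. Qed.

Lemma avgD n f g : avg n (fun u => f u + g u) = avg n f + avg n g.
Proof. by elim: n f g => [|n IH] f g //=; rewrite !IH; field. Qed.

Lemma avgZ n (c : R) f : avg n (fun u => c * f u) = c * avg n f.
Proof. by elim: n f => [|n IH] f //=; rewrite !IH; field. Qed.

Lemma avg_sum n (I : Type) (r : seq I) (F : I -> (nat -> bool) -> R) :
  avg n (fun u => \sum_(i <- r) F i u) = \sum_(i <- r) avg n (F i).
Proof.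
elim: r => [|i r IH].
  by rewrite big_nil -[RHS](avg_cst n); apply: eq_avg => u; rewrite big_nil.
by rewrite big_cons -IH -avgD; apply: eq_avg => u; rewrite big_cons.
Qed.

Definition agree (k : nat) u v := [forall i : 'I_k, u i == v i].

Lemma agreeP k u v : reflect (forall i, (i < k)%N -> u i = v i) (agree k u v).
Proof.
apply: (iffP forallP) => [h i ik|h i]; first exact/eqP/(h (Ordinal ik)).
by apply/eqP/h.
Qed.

Lemma agree_scons k b u v : agree k.+1 u (scons b v) =
  (u 0%N == b) && agree k (fun n => u n.+1) v.
Proof.
apply/agreeP/andP => [h|[/eqP h0 /agreeP h]].
  by split; [apply/eqP/(h 0%N)|apply/agreeP => i ik; exact: (h i.+1)].
by case=> [|i] ik //; exact: h.
Qed.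

Lemma avg_agree n k u : (k <= n)%N -> avg n (fun v => (agree k u v)%:R) = 2^-1 ^+ k.
Proof.
elim: n k u => [|n IH] [|k] u //= kn.
- by rewrite (_ : agree 0 u _ = true) //; apply/agreeP.
- rewrite -[RHS](avg_cst n.+1); apply: (@eq_avg n.+1 (fun v => (agree 0 u v)%:R)) => v.
  by rewrite (_ : agree 0 u _ = true) //; apply/agreeP.
have aE b : avg n (fun v => (agree k.+1 u (scons b v))%:R) =
    (u 0%N == b)%:R * 2^-1 ^+ k.
  rewrite -(IH k (fun n => u n.+1)) // -avgZ; apply: eq_avg => v.
  by rewrite agree_scons; case: (_ == b) => /=; rewrite ?mul1r ?mul0r.
by rewrite !aE exprS; case: (u 0%N) => /=; field.
Qed.

Lemma avg_stable m n f : (m <= n)%N ->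
  (forall u v, agree m u v -> f u = f v) -> avg n f = avg m f.
Proof.
elim: n m f => [|n IH] [|m] f //= mn fm.
  rewrite -[RHS](avg_cst n.+1); apply: (@eq_avg n.+1) => u.
  by apply: fm; apply/agreeP.
have h b : avg n (fun u => f (scons b u)) = avg m (fun u => f (scons b u)).
  apply: IH => // u v /agreeP uv; apply: fm; rewrite agree_scons /= eqxx /=.
  exact/agreeP.
by rewrite !h.
Qed.

Lemma markov_avg n f (c : R) : (forall u, 0 <= f u) -> 0 < c ->
  avg n (fun u => (c < f u)%R%:R) <= avg n f / c.
Proof.
move=> f0 c0; rewrite mulrC -avgZ; apply: ler_avg => u.
by case: ltP => [cf|_] /=; rewrite ?mulr_ge0 ?invr_ge0 ?(ltW c0) // ler_pdivlMl ?mulr1 ?ltW.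
Qed.

End Average.

(** König's lemma: without a uniform bound, a prefix that admits none can be extended forever by
    such prefixes, and the infinite word so built has no bound of its own. *)
Lemma fan_theorem (P : (nat -> bool) -> nat -> Prop) :
  (forall u v n, agree n u v -> P u n -> P v n) ->
  (forall u m n, (m <= n)%N -> P u m -> P u n) ->
  (forall u, exists n, P u n) -> exists n, forall u, P u n.
Proof.
move=> Pagree Pmono Pbar; apply: contrapT => nP.
pose cat (s : seq bool) u : nat -> bool := fun i => if (i < size s)%N then nth true s i else u (i - size s)%N.
pose bad s := ~ exists n, forall u, P (cat s u) n.
have bad_step s : bad s -> exists b, bad (rcons s b).
  move=> bs; apply: contrapT => nb; apply: bs.
  have good b : exists n, forall u, P (cat (rcons s b) u) n.
    by apply: contrapT => h; apply: nb; exists b.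
  have [n1 h1] := good true; have [n2 h2] := good false.
  exists (maxn n1 n2) => u.
  have uE : cat s u = cat (rcons s (u 0%N)) (fun i => u i.+1).
    apply/funext => i; rewrite /cat size_rcons nth_rcons.
    case: (ltngtP i (size s)) => h.
    - by rewrite ltnS ltnW.
    - by rewrite ltnS leqNgt h /=; congr u; lia.
    - by rewrite h ltnSn subnn.
  rewrite uE; case: (u 0%N).
    by apply: Pmono (h1 _); rewrite leq_maxl.
  by apply: Pmono (h2 _); rewrite leq_maxr.
pose step s := if pselect (exists b, bad (rcons s b)) is left h then rcons s (sval (cid h)) else s.
pose path := fix path n := if n is m.+1 then step (path m) else [::].
have badp n : bad (path n).
  elim: n => [|n IH] /=.
    case=> n h; apply: nP; exists n => u; have := h u.
    by rewrite (_ : cat _ u = u) //; apply/funext => i; rewrite /cat /= subn0.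
  rewrite /step; case: pselect => [h|[]]; last exact: bad_step.
  by case: (cid h).
have pathS n : exists b, path n.+1 = rcons (path n) b.
  rewrite /= /step; case: pselect => [h|[]]; last exact: bad_step.
  by exists (sval (cid h)).
have szp n : size (path n) = n.
  by elim: n => // n IH; have [b ->] := pathS n; rewrite size_rcons IH.
pose u n := nth true (path n.+1) n.
have pathE n i : (i < n)%N -> nth true (path n) i = u i.
  elim: n => // n IH; rewrite ltnS leq_eqVlt => /orP[/eqP -> //|ltin].
  by have [b ->] := pathS n; rewrite nth_rcons szp ltin IH.
have [n Pn] := Pbar u.
apply: (badp n); exists n => v; apply: Pagree Pn.
by apply/agreeP => i ltin; rewrite /cat szp ltin pathE.
Qed.

(** * Covers and sets of zero Hausdorff measure *)

Section HausdorffNull.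
Variable R : realType.
Implicit Types (s t d e x c : R) (E U : set (cpx R)).

Lemma diam_ge0 U : (0%:E <= diam U)%E.
Proof. by apply: ereal_sup_ubound; left. Qed.

Lemma diam_le U c : 0 <= c ->
  (forall z w, U z -> U w -> cabs (csub z w) <= c) -> (diam U <= c%:E)%E.
Proof.
move=> c0 Uc; apply: ge_ereal_sup => _ [->|[z Uz [w Uw <-]]]; rewrite lee_fin //.
exact: Uc.
Qed.

Lemma fin_diam U d : (diam U <= d%:E)%E -> diam U = (fine (diam U))%:E.
Proof.
move=> Ud; rewrite fineK // ge0_fin_numE ?diam_ge0 //.
by apply: le_lt_trans Ud _; rewrite ltry.
Qed.

Lemma cabs_le_diam U d z w : (diam U <= d%:E)%E -> U z -> U w ->
  cabs (csub z w) <= fine (diam U).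
Proof.
move=> /fin_diam Ud Uz Uw; rewrite -lee_fin -Ud.
by apply: ereal_sup_ubound; right; exists z => //; exists w.
Qed.

(** The cover carries real upper bounds [dd] of the diameters, and its cost is controlled through
    partial sums, so no extended reals occur. An empty set can take the bound 0, which is free when
    s > 0. *)
Definition hcov s d e E := exists (U : nat -> set (cpx R)) (dd : nat -> R),
  [/\ E `<=` \bigcup_i U i, forall i, 0 <= dd i <= d,
      forall i z w, U i z -> U i w -> cabs (csub z w) <= dd i
    & forall n, \sum_(i < n) dd i `^ s <= e].

Definition hnull s E := forall d e, 0 < d -> 0 < e -> hcov s d e E.

Local Notation hcost s U := (if U == set0 then 0%E else ((fine (diam U)) `^ s)%:E).

Lemma hcost_ge0 s U : (0 <= hcost s U)%E.
Proof. by case: ifP => // _; rewrite lee_fin powR_ge0. Qed.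

Lemma hcontent_ge0 s d E : (0 <= hcontent s d E)%E.
Proof.
apply: le_ereal_inf_tmp => _ [U _ <-].
by apply: nneseries_ge0 => i _ _; exact: hcost_ge0.
Qed.

Lemma hnull_hmeasure s E : 0 <= s -> hnull s E -> hmeasure s E = 0%E.
Proof.
move=> s0 Es; apply/eqP; rewrite eq_le; apply/andP; split; last first.
  apply: le_trans (hcontent_ge0 s 1 E) _.
  by apply: ereal_sup_ubound; exists 1; rewrite /= ?ltr01.
apply: ge_ereal_sup => _ [d d0 <-]; apply/lee_addgt0Pr => e e0; rewrite add0e.
have [U [dd [EU dd0 Udd dde]]] := Es _ _ d0 e0.
have Ud i : (diam (U i) <= (dd i)%:E)%E.
  by apply: diam_le (Udd i); case/andP: (dd0 i).
apply: (@le_trans _ _ (\sum_(0 <= i <oo) hcost s (U i))%E).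
  apply: ereal_inf_lbound; exists U => //; split => // i.
  by apply: le_trans (Ud i) _; rewrite lee_fin; case/andP: (dd0 i).
apply: lime_le; first by apply: is_cvg_nneseries => i _ _; exact: hcost_ge0.
apply: nearW => n; apply: (@le_trans _ _ (\sum_(i < n) (dd i `^ s)%:E)%E).
  rewrite big_mkord; apply: lee_sum => i _; case: ifP => _.
    by rewrite lee_fin powR_ge0.
  rewrite lee_fin ge0_ler_powR ?nnegrE //; first exact: fine_ge0 (diam_ge0 _).
    by case/andP: (dd0 i).
  by rewrite -lee_fin -(fin_diam (Ud i)).
by rewrite sumEFin lee_fin.
Qed.

Lemma ge0_powR_exp_le x s t : 0 <= x <= 1 -> 0 < t -> s <= t -> x `^ t <= x `^ s.
Proof.
move=> /andP[]; rewrite le_eqVlt => /predU1P[<-|x0] x1 t0 st.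
  by rewrite powR0 ?gt_eqF // powR_ge0.
by apply: ger_powR => //; rewrite x0.
Qed.

Lemma hmeasure_hnull s t E : 0 < t -> s <= t -> hmeasure s E = 0%E -> hnull t E.
Proof.
move=> t0 st Es d e d0 e0.
(* Raising the exponent lowers the cost only for diameters at most 1. *)
pose m := Num.min d 1.
have d1 : 0 < m by rewrite lt_min d0 ltr01.
have : (hcontent s (m) E < e%:E)%E.
  apply: (@le_lt_trans _ _ 0%E); last by rewrite lte_fin.
  by rewrite -Es; apply: ereal_sup_ubound; exists (m).
move=> /ereal_inf_lt[_ [U [EU Ud] <-]] Ue.
pose dd i := if U i == set0 then 0 else fine (diam (U i)).
have dd0 i : 0 <= dd i <= m.
  rewrite /dd; case: ifP => _; first by rewrite lexx ltW.
  by rewrite fine_ge0 ?diam_ge0 // -lee_fin -(fin_diam (Ud i)) Ud.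
exists U, dd; split => //.
- by move=> i; have := dd0 i; rewrite /m le_min => /and3P[-> ->].
- move=> i z w Uz Uw; rewrite /dd; case: ifPn => [/eqP U0|_].
    by move: Uz; rewrite U0.
  exact: cabs_le_diam (Ud i) Uz Uw.
move=> n; rewrite -lee_fin -sumEFin.
apply: le_trans (ltW Ue); rewrite -(big_mkord xpredT (fun i => (dd i `^ t)%:E)).
apply: le_trans (nneseries_lim_ge n _); last by move=> i _ _; exact: hcost_ge0.
apply: lee_sum => i _; have := dd0 i; rewrite /dd; case: ifP => _.
  by rewrite powR0 ?gt_eqF.
rewrite /m le_min => /and3P[h0 _ h1]; rewrite lee_fin ge0_powR_exp_le // h0 //.
Qed.

Lemma hdim_lt_hnull t E : 0 < t -> (hdim E < t%:E)%E -> hnull t E.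
Proof.
move=> t0 /ereal_inf_lt[_ [s [s0 Es] <-]]; rewrite lte_fin => st.
exact: hmeasure_hnull (ltW st) Es.
Qed.

Lemma hnull_hdim_le t E : 0 <= t -> hnull t E -> (hdim E <= t%:E)%E.
Proof.
move=> t0 Et; apply: ereal_inf_lbound; exists t => //; split => //.
exact: hnull_hmeasure.
Qed.

Lemma hdim_ge0 E : (0 <= hdim E)%E.
Proof. by apply: le_ereal_inf_tmp => _ [s [s0 _] <-]; rewrite lee_fin. Qed.

Lemma hcov_sub s d d' e e' E E' : d' <= d -> e' <= e -> E `<=` E' ->
  hcov s d' e' E' -> hcov s d e E.
Proof.
move=> dd' ee' EE' [U [dd [EU dd0 Udd dde]]]; exists U, dd; split => //.
- exact: subset_trans EE' EU.
- by move=> i; have /andP[-> h] := dd0 i; rewrite (le_trans h).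
- by move=> n; rewrite (le_trans (dde n)).
Qed.

Lemma hnull_sub s E E' : E `<=` E' -> hnull s E' -> hnull s E.
Proof. by move=> EE' H d e d0 e0; apply: hcov_sub EE' (H d e d0 e0). Qed.

Lemma hcov0 s d : 0 < s -> 0 <= d -> hcov s d 0 set0.
Proof.
move=> s0 d0; exists (fun=> set0), (fun=> 0); split => //.
- by move=> i; rewrite lexx.
- by move=> n; rewrite big1 // => i _; rewrite powR0 ?gt_eqF.
Qed.

Lemma ler_sum_sub (T : eqType) (r r' : seq T) (F : T -> R) :
  uniq r -> uniq r' -> {subset r <= r'} -> (forall i, 0 <= F i) ->
  \sum_(i <- r) F i <= \sum_(i <- r') F i.
Proof.
move=> ur ur' rr' F0.
have pr : perm_eq r [seq i <- r' | i \in r].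
  apply: uniq_perm => //; first exact: filter_uniq.
  by move=> i; rewrite mem_filter; case ir: (i \in r) => //=; rewrite rr'.
rewrite (perm_big _ pr) big_filter /= big_mkcond; apply: ler_sum => i _.
by case: ifP.
Qed.

Lemma hcov_bigcup s d e (E : nat -> set (cpx R)) (ee : nat -> R) :
  0 < s -> 0 <= d -> (forall i, hcov s d (ee i) (E i)) ->
  (forall n, \sum_(i < n) ee i <= e) -> hcov s d e (\bigcup_i E i).
Proof.
move=> s0 d0 Eh eeh.
have /choice[U /choice[dd Udd]] := Eh.
pose V k := oapp (fun p : nat * nat => U p.1 p.2) set0 (pickle_inv k).
pose dv k := oapp (fun p : nat * nat => dd p.1 p.2) 0 (pickle_inv k).
exists V, dv; split.
- move=> z [i _ Ez]; have [EU _ _ _] := Udd i; have [j _ Uz] := EU _ Ez.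
  by exists (pickle (i, j)) => //; rewrite /V pickleK_inv.
- rewrite /dv => k; case: (pickle_inv k) => [[i j]|] /=; last by rewrite lexx.
  by have [_ h _ _] := Udd i.
- rewrite /dv /V => k z w; case: (pickle_inv k) => [[i j]|] //=.
  by have [_ _ h _] := Udd i; exact: h.
move=> n; pose F (p : nat * nat) := dd p.1 p.2 `^ s.
pose r := pmap (@pickle_inv (nat * nat)%type) (iota 0 n).
have -> : \sum_(i < n) dv i `^ s = \sum_(p <- r) F p.
  rewrite big_pmap -(big_mkord xpredT (fun i => dv i `^ s)) /index_iota subn0.
  apply: eq_bigr => k _; rewrite /dv; case: pickle_inv => //=.
  by rewrite powR0 ?gt_eqF.
(* Finitely many codes involve only pairs inside some square, whose side is bounded crudely by the
   sum of all coordinates. *)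
pose N := (\sum_(p <- r) (p.1 + p.2)).+1.
have rN p : p \in r -> (p.1 < N)%N /\ (p.2 < N)%N.
  move=> pr; rewrite /N (big_rem _ pr) /=; lia.
apply: le_trans (_ : \sum_(p <- [seq (i, j) | i <- iota 0 N, j <- iota 0 N]) F p <= _).
  apply: ler_sum_sub.
  - by apply: (pmap_uniq (@pickle_invK _)); exact: iota_uniq.
  - by apply: allpairs_uniq => [||[? ?] [? ?]] //; exact: iota_uniq.
  - move=> [i j] /rN[iN jN].
    by apply/allpairsP; exists (i, j); rewrite !mem_iota !add0n.
  - by move=> p; exact: powR_ge0.
rewrite big_allpairs; apply: le_trans (eeh N).
rewrite -(big_mkord xpredT ee) /index_iota subn0; apply: ler_sum => i _.
have [_ _ _] := Udd i => /(_ N); apply: le_trans.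
by rewrite -(big_mkord xpredT (fun j => dd i j `^ s)) /index_iota subn0.
Qed.

Lemma geometric_sum_le x n : 0 <= x < 1 -> \sum_(i < n) x ^+ i <= (1 - x)^-1.
Proof.
move=> /andP[x0 x1]; rewrite -[leRHS]mul1r ler_pdivlMr ?subr_gt0 //.
rewrite mulrC -opprB mulNr -subrX1 opprB lerBlDr lerDl exprn_ge0 //.
Qed.

Lemma exprn_lt x e : 0 <= x < 1 -> 0 < e -> exists n, x ^+ n < e.
Proof.
move=> /andP[x0 x1] e0.
have /cvgrPdist_lt /(_ e e0) : (GRing.exp x : R ^nat) @ \oo --> (0 : R).
  by apply: cvg_expr; rewrite ger0_norm.
move=> [n _ /(_ n (leqnn _))] /=; rewrite sub0r normrN => h.
by exists n; apply: le_lt_trans (ler_norm _) h.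
Qed.

Lemma hnull_bigcup (T : countType) s (E : T -> set (cpx R)) : 0 < s ->
  (forall i, hnull s (E i)) -> hnull s (\bigcup_i E i).
Proof.
move=> s0 Es d e d0 e0.
pose E' n := if unpickle n is Some i then E i else set0.
apply: (@hcov_sub _ d d e e _ (\bigcup_n E' n)) => //.
  by move=> z [i _ Ez]; exists (pickle i) => //; rewrite /E' pickleK.
apply: (@hcov_bigcup _ _ _ _ (fun n => e / 2 * 2^-1 ^+ n)) => //; first exact: ltW.
  move=> n; have en : 0 < e / 2 * 2^-1 ^+ n by rewrite mulr_gt0 ?exprn_gt0 ?divr_gt0.
  rewrite /E'; case: unpickle => [i|]; first exact: Es.
  by apply: hcov_sub (hcov0 s0 (ltW d0)) => //; exact: ltW.
move=> n; rewrite -mulr_sumr.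
have := @geometric_sum_le 2^-1 n ltac:(lra).
rewrite (_ : (1 - 2^-1)^-1 = 2 :> R); last by field.
rewrite -(ler_pM2l (_ : 0 < e / 2)) ?divr_gt0 // => /le_trans; apply.
by rewrite divfK.
Qed.

(** Cantelli's argument: every tail of the sequence [B] covers E, and the costs of the tails are
    tails of a geometric series. *)
Lemma hnull_limsup s c x (B : nat -> set (cpx R)) E : 0 < s -> 0 <= c -> 0 <= x < 1 ->
  (forall d, 0 < d -> exists j0, forall j, (j0 <= j)%N -> hcov s d (c * x ^+ j) (B j)) ->
  (forall z j0, E z -> exists2 j, (j0 <= j)%N & B j z) -> hnull s E.
Proof.
move=> s0 c0 x01 Bh EB d e d0 e0; have /andP[x0 x1] := x01.
have [j1 j1h] := Bh d d0.
have [j2 j2h] : exists j, x ^+ j < e * (1 - x) / (c + 1).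
  by apply: exprn_lt => //; rewrite divr_gt0 ?mulr_gt0 ?subr_gt0 ?ltr_wpDl.
pose j0 := maxn j1 j2.
apply: (@hcov_sub _ d d e e _ (\bigcup_i B (j0 + i)%N)) => //.
  move=> z /(EB _ j0)[j j0j Bz]; exists (j - j0)%N => //.
  by rewrite subnKC.
apply: (@hcov_bigcup _ _ _ _ (fun i => c * x ^+ (j0 + i))) => //; first exact: ltW.
  by move=> i; apply: j1h; rewrite (leq_trans (leq_maxl j1 j2)) ?leq_addr.
move=> n; under eq_bigr do rewrite exprD mulrA.
rewrite -mulr_sumr.
apply: (@le_trans _ _ ((c + 1) * x ^+ j2 * (1 - x)^-1)).
  rewrite ler_pM ?geometric_sum_le ?sumr_ge0 ?mulr_ge0 ?exprn_ge0 //.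
    by move=> i _; rewrite exprn_ge0.
  rewrite ler_pM ?exprn_ge0 // ?lerDl //.
  by rewrite ler_wiXn2l ?leq_maxr // ltW.
rewrite ler_pdivrMr ?subr_gt0 // mulrC -ler_pdivlMr ?ltr_wpDl //; exact: ltW.
Qed.

(** The cover consists of the balls of radius D / 2 about the points. The last hypothesis is the
    instance of the triangle inequality that bounds their diameters. *)
Lemma hcov_finite s d D E (pts : seq (cpx R)) : 0 < s -> 0 <= D <= d ->
  (forall z, E z -> exists2 p, p \in pts & cabs (csub p z) <= D / 2) ->
  (forall p z w, cabs (csub p z) <= D / 2 -> cabs (csub p w) <= D / 2 ->
     cabs (csub z w) <= D) ->
  hcov s d ((size pts)%:R * D `^ s) E.
Proof.
move=> s0 /andP[D0 Dd] Epts tri.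
pose U i := [set z : cpx R | (i < size pts)%N /\ cabs (csub (nth (0, 0) pts i) z) <= D / 2].
exists U, (fun i => if (i < size pts)%N then D else 0); split.
- move=> z /Epts[p ppts pz]; exists (index p pts) => //.
  by split; rewrite ?index_mem ?nth_index.
- by move=> i; case: ifP; rewrite ?D0 ?Dd ?lexx ?(le_trans D0).
- by move=> i z w [ip pz] [_ pw]; rewrite ip; exact: tri pz pw.
move=> n; apply: (@le_trans _ _ (\sum_(i < n) (i < size pts)%:R * D `^ s)).
  apply: ler_sum => i _; case: ifP => _; rewrite ?mul1r // mul0r.
  by rewrite powR0 ?gt_eqF.
rewrite -mulr_suml ler_wpM2r ?powR_ge0 // -natr_sum ler_nat.
rewrite -(big_mkord xpredT (fun i => (i < size pts)%N : nat)).
elim: {Epts U tri} pts n => [|p pts IH] n; first by rewrite big1.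
case: n => [|n]; first by rewrite big_geq.
by rewrite big_nat_recl //= add1n ltnS IH.
Qed.

End HausdorffNull.

(** * Points of A_lam, their finite truncations, and the inner radius of M *)

Section Points.
Variable R : realType.
Implicit Types (z w : cpx R) (lam : R[i]) (u v : nat -> bool) (x e : R).

Definition toC z : R[i] := Complex z.1 z.2.

Lemma cabsE z : cabs z = normc (toC z). Proof. by []. Qed.

Lemma toC_csub z w : toC (csub z w) = toC z - toC w. Proof. by []. Qed.

Lemma toC_cexp z n : toC (cexp z n) = toC z ^+ n.
Proof.
elim: n => [|n IH] //; rewrite exprSr -IH /=.
by case: z {IH} (cexp z n) => a b [c d].
Qed.

Lemma toC_cscale x z : toC (Defs.cscale x z) = x%:C * toC z.
Proof.
apply/eqP; rewrite eq_complex /=; apply/andP; split; apply/eqP; ring.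
Qed.

Lemma cabs_ge0 z : 0 <= cabs z. Proof. by rewrite cabsE normc_ge0. Qed.

Lemma cabs_subC z w : cabs (csub z w) = cabs (csub w z).
Proof. by rewrite !cabsE !toC_csub -normcN opprB. Qed.

Lemma cabs_triangle (y z w : cpx R) : cabs (csub z w) <= cabs (csub z y) + cabs (csub y w).
Proof.
rewrite !cabsE !toC_csub -(subrKA (toC y)); exact: le_normcD.
Qed.

Lemma normcX lam n : normc (lam ^+ n) = normc lam ^+ n.
Proof. by elim: n => [|n IH]; rewrite ?expr0 ?normc1 // !exprS normcM IH. Qed.

Lemma normc_le_ReIm lam : normc lam <= `|complex.Re lam| + `|complex.Im lam|.
Proof.
rewrite -(@ler_pXn2r _ 2) ?nnegrE ?addr_ge0 ?normc_ge0 // normc_sqr.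
by rewrite sqrrD !real_normK ?num_real // [leRHS]addrAC lerDl mulrn_wge0 ?mulr_ge0.
Qed.

Lemma ler_normc_sum (I : Type) (r : seq I) (P : pred I) (F : I -> R[i]) :
  normc (\sum_(i <- r | P i) F i) <= \sum_(i <- r | P i) normc (F i).
Proof.
elim/big_ind2: _ => [|a b c d ab cd|//]; first by rewrite normc0.
by apply: le_trans (le_normcD _ _) _; exact: lerD.
Qed.

Lemma toC_sum (U : nat -> cpx R) n : \sum_(i < n) toC (U i) =
  Complex (\sum_(i < n) (U i).1) (\sum_(i < n) (U i).2).
Proof. by elim: n => [|n IH]; rewrite ?big_ord0 // !big_ord_recr IH. Qed.

Lemma cseries_tail (U : nat -> cpx R) z x m : 0 <= x < 1 ->
  (forall i, normc (toC (U i)) <= x ^+ i) -> cseries_to U z ->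
  normc (toC z - \sum_(i < m) toC (U i)) <= x ^+ m / (1 - x).
Proof.
move=> x01 Ux [c1 c2]; have /andP[x0 x1] := x01.
apply/ler_addgt0Pr => e e0.
have e2 : 0 < e / 2 by rewrite divr_gt0.
have [n1 _ h1] := (cvgrPdist_lt _ _).1 c1 (e / 2) e2.
have [n2 _ h2] := (cvgrPdist_lt _ _).1 c2 (e / 2) e2.
pose n := maxn n1 n2.
have S1 : normc (toC z - \sum_(i < m + n) toC (U i)) <= e.
  rewrite toC_sum; apply: le_trans (normc_le_ReIm _) _; rewrite [e]splitr /=.
  apply: lerD; apply: ltW; [apply: h1|apply: h2] => /=.
    by rewrite (leq_trans (leq_maxl n1 n2)) ?leq_addl.
  by rewrite (leq_trans (leq_maxr n1 n2)) ?leq_addl.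
have S2 : normc (\sum_(i < m + n) toC (U i) - \sum_(i < m) toC (U i)) <= x ^+ m / (1 - x).
  rewrite big_split_ord /= addrAC subrr add0r.
  apply: le_trans (ler_normc_sum _ _ _) _.
  apply: (@le_trans _ _ (x ^+ m * \sum_(i < n) x ^+ i)).
    by rewrite mulr_sumr; apply: ler_sum => i _; rewrite -exprD; exact: Ux.
  by rewrite ler_wpM2l ?exprn_ge0 ?geometric_sum_le.
rewrite -(subrKA (\sum_(i < m + n) toC (U i))).
by apply: le_trans (le_normcD _ _) _; rewrite [leRHS]addrC lerD.
Qed.

Lemma abs_series_cvg (a : nat -> R) x : 0 <= x < 1 -> (forall i, `|a i| <= x ^+ i) ->
  exists l : R, (fun n => \sum_(i < n) a i) @ \oo --> l.
Proof.
move=> /andP[x0 x1] ax; pose l := lim (series a @ \oo).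
exists l; rewrite (_ : (fun n => _) = series a); last first.
  by apply/funext => n; rewrite /series /= big_mkord.
apply: normed_cvg; apply: (@series_le_cvg _ _ (fun i => x ^+ i)) => //.
- by move=> i /=.
- by move=> i; rewrite exprn_ge0.
- have := @is_cvg_geometric_series R 1 x; rewrite ger0_norm // => /(_ x1).
  by rewrite (_ : geometric 1 x = (fun i => x ^+ i)) //; apply/funext => i /=; rewrite mul1r.
Qed.

Lemma cseries_ex (U : nat -> cpx R) x : 0 <= x < 1 ->
  (forall i, normc (toC (U i)) <= x ^+ i) -> exists z, cseries_to U z.
Proof.
move=> x01 Ux.
have [l1 h1] := @abs_series_cvg (fun i => (U i).1) x x01
  (fun i => le_trans (ge_normc_Re (toC (U i))) (Ux i)).
have [l2 h2] := @abs_series_cvg (fun i => (U i).2) x x01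
  (fun i => le_trans (ge_normc_Im (toC (U i))) (Ux i)).
by exists (l1, l2).
Qed.

Definition sgn (b : bool) : R := if b then 1 else -1.

Definition pt lam M u : R[i] := \sum_(i < M) (sgn (u i))%:C * lam ^+ i.

Lemma normr_sgn b : `|sgn b| = 1.
Proof. by case: b; rewrite /sgn ?normrN normr1. Qed.

Definition digits z u n := Defs.cscale (sgn (u n)) (cexp z n).

Lemma toC_digits z u i : toC (digits z u i) = (sgn (u i))%:C * toC z ^+ i.
Proof. by rewrite toC_cscale toC_cexp. Qed.

Lemma normc_digits z u i : normc (toC (digits z u i)) <= cabs z ^+ i.
Proof. by rewrite toC_digits normcM normcX normc_real normr_sgn mul1r. Qed.

Lemma Aset_pt z w u M : cabs z < 1 -> cseries_to (digits z u) w ->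
  normc (toC w - pt (toC z) M u) <= cabs z ^+ M / (1 - cabs z).
Proof.
move=> z1 cw.
have -> : pt (toC z) M u = \sum_(i < M) toC (digits z u i).
  by apply: eq_bigr => i _; rewrite toC_digits.
by apply: cseries_tail => //; [rewrite cabs_ge0|exact: normc_digits].
Qed.

Lemma digits_cvg z u : cabs z < 1 -> exists w, cseries_to (digits z u) w.
Proof.
move=> z1; apply: (@cseries_ex _ (cabs z)); first by rewrite cabs_ge0.
exact: normc_digits.
Qed.

Lemma eq_pt lam M u v : agree M u v -> pt lam M u = pt lam M v.
Proof. by move=> /agreeP uv; apply: eq_bigr => i _; rewrite uv. Qed.

(** The constant term 1 must be cancelled by the other terms, whose sum is at most |lam| / (1 -
    |lam|) in modulus. *)
Lemma Mset_cabs z : Mset z -> 1 / 2 <= cabs z.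
Proof.
case=> z1 [a [a3 ca]].
have x01 : 0 <= cabs z < 1 by rewrite cabs_ge0.
have := @cseries_tail _ _ _ 1 x01 _ ca.
rewrite big_ord1 expr1 => h.
have {h} : normc (toC (0, 0) - toC (1, 0)) <= cabs z / (1 - cabs z).
  apply: h => -[|i]; first by rewrite expr0 /= expr1n expr0n addr0 sqrtr1.
  rewrite toC_cscale normcM normc_real toC_cexp normcX -cabsE.
  rewrite ler_piMl ?exprn_ge0 ?cabs_ge0 //.
  by case/orP: (a3 i.+1) => [/orP[]|] /eqP ->;
    rewrite ?rmorph0 ?normr0 // ?rmorphN ?rmorph1 ?normrN normr1.
have -> : normc (toC (0, 0) - toC (1, 0)) = 1 :> R.
  by rewrite /= subr0 sub0r sqrrN expr1n expr0n addr0 sqrtr1.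
by rewrite ler_pdivlMr ?subr_gt0 //; lra.
Qed.

End Points.

(** * Counting the parameters at which many pairs of words come close *)

Section ClosePairs.
Variable R : realType.
Implicit Types (z w : cpx R) (lam : R[i]) (u v : nat -> bool) (c x e : R).

Definition close lam M c u v : bool := normc (pt lam M u - pt lam M v) <= c.

Definition fdiff k u v := agree k u v && (u k != v k).

Lemma agree_fdiff k u v :
  (agree k u v)%:R = (fdiff k u v)%:R + (agree k.+1 u v)%:R :> R.
Proof.
have -> : agree k.+1 u v = agree k u v && (u k == v k).
  apply/agreeP/andP => [h|[/agreeP h /eqP hk] i].
    by split; [apply/agreeP => i ik; apply: h; exact: ltnW|apply/eqP/h].
  by rewrite ltnS leq_eqVlt => /orP[/eqP ->|/h].
by rewrite /fdiff; case: agree; case: eqVneq => /=; rewrite ?addr0 ?add0r.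
Qed.

Lemma agree_split K u v :
  1 = \sum_(k < K) (fdiff k u v)%:R + (agree K u v)%:R :> R.
Proof.
elim: K => [|K IH]; first by rewrite big_ord0 add0r (_ : agree 0 u v) //; apply/agreeP.
by rewrite big_ord_recr /= -addrA -agree_fdiff.
Qed.

(** The half differences of signs lie in {-1, 0, 1}, and the one at i = 0 is 1 or -1, so the
    remaining polynomial is of the kind treated by [transversality]. *)
Lemma pt_fdiff lam k m u v : fdiff k u v ->
  pt lam (k + m) u - pt lam (k + m) v =
  2%:C * lam ^+ k * \sum_(i < m) ((sgn R (u (k + i)%N) - sgn R (v (k + i)%N)) / 2)%:C * lam ^+ i.
Proof.
case/andP=> /agreeP uv _; rewrite /pt !big_split_ord /=.
have -> : \sum_(i < k) (sgn R (u i))%:C * lam ^+ i =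
          \sum_(i < k) (sgn R (v i))%:C * lam ^+ i.
  by apply: eq_bigr => i _; rewrite uv.
rewrite opprD addrACA subrr add0r -sumrB mulr_sumr; apply: eq_bigr => i _.
rewrite exprD -mulrBl -rmorphB /=.
set s := _ - _; rewrite (_ : s%:C = 2%:C * (s / 2)%:C); first by ring.
by rewrite -rmorphM /=; congr (_%:C); field.
Qed.

(** The flag [b] selects a half-plane, since [transversality] compares only parameters on the same
    side of the real axis. *)
Definition region (q eta : R) (b : bool) z := [/\ q <= cabs z, cabs z ^+ 2 <= 1 / 2,
  eta <= `|z.2| & (0 < z.2) = b].

Definition pairs k M c z := avg M (fun u => avg M (fun v =>
  (fdiff k u v && close (toC z) M c u v)%:R)) : R.

Section TransversePairs.
Variables (q eta C : R) (b : bool).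
Hypotheses (q0 : 0 < q) (eta0 : 0 < eta).
Hypothesis transC : forall (bb : nat -> R) m (z w : R[i]) dl,
    (forall i, `|bb i| <= 1) -> `|bb 0%N| = 1 ->
    normc z ^+ 2 <= 1 / 2 -> normc w ^+ 2 <= 1 / 2 ->
    eta <= `|complex.Im z| -> eta <= `|complex.Im w| ->
    0 < complex.Im z * complex.Im w ->
    normc (\sum_(i < m.+1) (bb i)%:C * z ^+ i) <= dl ->
    normc (\sum_(i < m.+1) (bb i)%:C * w ^+ i) <= dl ->
    normc (w - z) <= C * dl.

Lemma fdiff_close k M c u v z : (k < M)%N -> 0 <= c -> region q eta b z -> fdiff k u v ->
  close (toC z) M c u v ->
  normc (\sum_(i < (M - k).-1.+1)
    ((sgn R (u (k + i)%N) - sgn R (v (k + i)%N)) / 2)%:C * toC z ^+ i) <= c / (2 * q ^+ k).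
Proof.
move=> kM c0 [qz _ _ _] fuv; rewrite /close.
have -> : M = (k + (M - k).-1.+1)%N by lia.
rewrite pt_fdiff // !normcM normc_real ger0_norm // normcX.
set S := normc (\sum_(i < _) _).
rewrite (_ : (k + (M - k).-1.+1 - k)%N = (M - k).-1.+1); last by lia.
rewrite -/S => h; rewrite ler_pdivlMr ?mulr_gt0 ?exprn_gt0 //.
apply: le_trans h; rewrite mulrC ler_wpM2r ?normc_ge0 // ler_wpM2l //.
by apply: lerXn2r; rewrite ?nnegrE ?normc_ge0 ?(ltW q0).
Qed.

Lemma close_region k M c u v z w : (k < M)%N -> 0 <= c ->
  region q eta b z -> region q eta b w -> fdiff k u v ->
  close (toC z) M c u v -> close (toC w) M c u v ->
  cabs (csub w z) <= C * (c / (2 * q ^+ k)).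
Proof.
move=> kM c0 rz rw fuv cz cw; rewrite cabsE toC_csub.
have [qz z2 ez bz] := rz; have [qw w2 ew bw] := rw.
apply: (@transC (fun i => (sgn R (u (k + i)%N) - sgn R (v (k + i)%N)) / 2)
  (M - k).-1 (toC z) (toC w)) => //.
- by move=> i; rewrite /sgn; case: (u _); case: (v _); rewrite ler_norml; lra.
- rewrite addn0; case/andP: fuv => _; rewrite /sgn.
  case: (u k); case: (v k) => // _.
    by rewrite (_ : (1 - -1) / 2 = 1) ?normr1 //; field.
  by rewrite (_ : (-1 - 1) / 2 = -1) ?normrN ?normr1 //; field.
- have := lt_le_trans eta0 ez; have := lt_le_trans eta0 ew.
  rewrite !normr_gt0 /= => w20 z20; case: b bz bw => /= bz bw.
    by rewrite mulr_gt0.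
  rewrite nmulr_rgt0; first by rewrite lt_neqAle w20 leNgt bw.
  by rewrite lt_neqAle z20 leNgt bz.
- exact: (fdiff_close kM c0 rz).
- exact: (fdiff_close kM c0 rw).
Qed.

(** The sum over parameters is moved inside the average over pairs of words. By [close_region] a
    given pair is close for at most one parameter of a separated set, and words agreeing up to k
    have probability 2^(-k). *)
Lemma sum_pairs k M c (s : seq (cpx R)) : (k < M)%N -> 0 <= c -> uniq s ->
  (forall z, z \in s -> region q eta b z) ->
  (forall z w, z \in s -> w \in s -> cabs (csub w z) <= C * (c / (2 * q ^+ k)) -> z = w) ->
  \sum_(z <- s) pairs k M c z <= 2^-1 ^+ k.
Proof.
move=> kM c0 us sr ssep; rewrite /pairs -avg_sum.
rewrite -[leRHS](avg_cst M); apply: ler_avg => u.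
rewrite -avg_sum -(avg_agree R u (ltnW kM)); apply: ler_avg => v.
have [fuv|] := boolP (fdiff k u v) => /=; last by rewrite big1.
have -> : agree k u v by case/andP: fuv.
pose P z := close (toC z) M c u v.
rewrite -natr_sum ler_nat (_ : (\sum_(z <- s) P z)%N = count P s); last first.
  by rewrite -sum1_count [RHS]big_mkcond; apply: eq_bigr => z _; case: (P z).
rewrite -size_filter; case def_s' : [seq z <- s | P z] => [|z [|w s']] //.
have := filter_uniq P us; rewrite def_s' /= inE => /andP[/norP[/eqP zw _] _].
have [zs Pz] : z \in s /\ P z.
  by apply/andP; rewrite andbC -mem_filter def_s' inE eqxx.
have [ws Pw] : w \in s /\ P w.
  by apply/andP; rewrite andbC -mem_filter def_s' !inE eqxx orbT.
by case: zw; apply: ssep => //; apply: close_region fuv Pz Pw => //; exact: sr.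
Qed.

(** By [sum_pairs] a D-separated subset of E has at most 2^(-k) / theta points. Balls of radius D
    about a largest such subset cover E, and their diameter is at most 2 D. *)
Lemma hcov_pairs k M c theta s d (E : set (cpx R)) : (k < M)%N -> 0 <= c -> 0 < theta ->
  0 < s -> 0 <= C -> C * (c / q ^+ k) <= d ->
  (forall z, E z -> region q eta b z /\ theta < pairs k M c z) ->
  hcov s d (2^-1 ^+ k / theta * (C * (c / q ^+ k)) `^ s) E.
Proof.
move=> kM c0 theta0 s0 C0 Dd Eh.
pose D := C * (c / (2 * q ^+ k)).
have D2 : C * (c / q ^+ k) = 2 * D by rewrite /D; field; rewrite expf_neq0 ?gt_eqF.
have D0 : 0 <= D by rewrite /D !mulr_ge0 ?invr_ge0 ?mulr_ge0 ?exprn_ge0 // ltW.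
pose sep (r : seq (cpx R)) := [/\ uniq r, forall z, z \in r -> E z &
  forall z w, z \in r -> w \in r -> cabs (csub w z) <= D -> z = w].
have sep_size r : sep r -> (size r)%:R <= 2^-1 ^+ k / theta.
  move=> [ur rE rsep]; rewrite ler_pdivlMr //.
  have h : \sum_(z <- r) pairs k M c z <= 2^-1 ^+ k.
    by apply: sum_pairs => // z /rE/Eh[].
  apply: le_trans h; rewrite -sum1_size natr_sum mulr_suml big_seq [leRHS]big_seq.
  by apply: ler_sum => z /rE/Eh[_ /ltW]; rewrite mul1r.
pose P n := `[< exists2 r, sep r & size r = n >].
have exP : exists n, P n.
  by exists 0%N; apply/asboolP; exists [::].
have ubP n : P n -> (n <= Num.bound (2^-1 ^+ k / theta))%N.
  move=> /asboolP[r sr <-]; rewrite -(ler_nat R); apply: le_trans (sep_size _ sr) _.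
  by apply: ltW; apply: archi_boundP; rewrite divr_ge0 ?exprn_ge0 // ltW.
case: (ex_maxnP exP ubP) => n /asboolP[r sr <-] rmax.
apply: (@hcov_sub _ _ d d _ ((size r)%:R * (2 * D) `^ s) _ E) => //.
  by rewrite D2 ler_wpM2r ?powR_ge0 // sep_size.
apply: hcov_finite => //.
- by rewrite -D2 Dd D2 mulr_ge0.
- move=> z Ez; rewrite (_ : 2 * D / 2 = D); last by field.
  apply: contrapT => nz; have [ur rE rsep] := sr.
  have zr p : p \in r -> ~~ (cabs (csub p z) <= D).
    by move=> pr; apply/negP => pz; apply: nz; exists p.
  have cabs0 : cabs (csub z z) <= D.
    by rewrite cabsE toC_csub subrr normc0.
  suff /rmax : P (size (z :: r)) by rewrite ltnn.
  apply/asboolP; exists (z :: r) => //; split.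
  + by rewrite /= ur andbT; apply/negP => /zr/negP; exact.
  + by move=> p; rewrite inE => /orP[/eqP ->|/rE].
  + move=> p p'; rewrite !inE => /orP[/eqP ->|pr] /orP[/eqP ->|p'r] // h.
    * by case/negP: (zr _ p'r).
    * by case/negP: (zr _ pr); rewrite cabs_subC.
    * exact: rsep.
- move=> p z w; rewrite (_ : 2 * D / 2 = D); last by field.
  move=> pz pw; apply: le_trans (cabs_triangle p _ _) _.
  rewrite (_ : 2 * D = D + D); last by ring.
  by rewrite lerD // cabs_subC.
Qed.
End TransversePairs.
End ClosePairs.

(** * From few close pairs to a lower bound for the dimension *)

Section LowerBound.
Variable R : realType.
Implicit Types (z w : cpx R) (u v : nat -> bool).

(* A bound on the fraction of pairs of words whose points are close bounds the
   dimension from below: by Markov most words see few other words nearby, so a set of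
   diameter [Q^j] contains a proportion at most [Q^(tj)] of them. *)
Lemma correlation_lower_bound z (Q t y A c0 : R) (M : nat -> nat) j0 :
  cabs z < 1 -> 0 < Q < 1 -> 0 < t -> 0 <= y < 1 -> 0 <= A -> 0 <= c0 ->
  {homo M : i j / (i <= j)%N} ->
  (forall j, cabs z ^+ M j / (1 - cabs z) <= c0 * Q ^+ j) ->
  (forall j, (j0 <= j)%N -> avg (M j) (fun u => avg (M j) (fun v =>
     (close (toC z) (M j) ((3 + 2 * c0) * Q ^+ j) u v)%:R)) <= A * (Q `^ t * y) ^+ j) ->
  ~ hnull t (Aset z).
Proof.
move=> z1 /andP[Q0 Q1] t0 y01 A0 c00 Mmono Mh Ph Anull; have /andP[y0 y1] := y01.
pose tau := Q `^ t; have tau0 : 0 < tau by rewrite powR_gt0.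
have tau1 : tau < 1.
  have := @gt0_ltr_powR _ _ t0 Q 1; rewrite powR1 /=.
  by apply; rewrite ?nnegrE // ltW.
have powQ n : (Q ^+ n) `^ t = tau ^+ n.
  by rewrite -powR_mulrn ?ltW // powRAC powR_mulrn ?ltW.
have QX n : 0 < Q ^+ n by rewrite exprn_gt0.
(* Past scale j1 the words that see too many neighbours at some scale will have total probability at
   most 1/4. *)
have [j1 j01 j1h] : exists2 j1, (j0 <= j1)%N & A * y ^+ j1 / (1 - y) <= 1 / 4.
  have [j jh] : exists j, y ^+ j < (1 - y) / (4 * (A + 1)).
    by apply: exprn_lt => //; rewrite divr_gt0 ?subr_gt0 ?mulr_gt0 ?ltr_wpDl.
  exists (maxn j0 j); rewrite ?leq_maxl // ler_pdivrMr ?subr_gt0 //.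
  apply: (@le_trans _ _ ((A + 1) * y ^+ j)).
    by rewrite ler_pM ?exprn_ge0 ?lerDl // ler_wiXn2l ?leq_maxr // ltW.
  have A4 : 0 < 4 * (A + 1) by lra.
  by move: jh; rewrite ltr_pdivlMr //; lra.
have [pi pih] := choice (fun u => digits_cvg u z1).
have piA u : Aset z (pi u) by exists u; exact: pih.
have pid u j : normc (toC (pi u) - pt (toC z) (M j) u) <= c0 * Q ^+ j.
  by apply: le_trans (Mh j); exact: Aset_pt.
pose e := tau / 8; have e0 : 0 < e by rewrite divr_gt0.
have [U [dd [AU dd0 Udd dde]]] := Anull _ _ (QX j1) e0.
(* Each covering set gets the scale Q^j just above its diameter; this rounding costs the factor 1 /
   tau. A set with bound 0 has no such scale, and the summable extra term pays for an arbitrarily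
   fine one. *)
have /choice[jj jjh] i : exists j, [/\ (j1 <= j)%N, dd i <= Q ^+ j &
    tau ^+ j <= tau^-1 * dd i `^ t + e / 2 * 2^-1 ^+ i].
  have /andP[] := dd0 i; rewrite le_eqVlt => /predU1P[<- _|di dQ].
    have ei : 0 < e / 2 * 2^-1 ^+ i by rewrite mulr_gt0 ?divr_gt0 ?exprn_gt0.
    have [j jh] : exists j, tau ^+ j < e / 2 * 2^-1 ^+ i.
      by apply: exprn_lt => //; rewrite (ltW tau0).
    exists (maxn j1 j); rewrite leq_maxl ltW //; split => //.
    rewrite powR0 ?gt_eqF // mulr0 add0r; apply: le_trans (ltW jh).
    by rewrite ler_wiXn2l ?leq_maxr // ltW.
  have exj : exists j, Q ^+ j < dd i by apply: exprn_lt => //; rewrite (ltW Q0).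
  case: (ex_minnP exj) => j jd jmin.
  have j1j : (j1 < j)%N.
    rewrite ltnNge; apply/negP => jj1; move: jd; rewrite ltNge => /negP; apply.
    by apply: le_trans dQ _; rewrite ler_wiXn2l // ltW.
  exists j.-1; split; first by rewrite -ltnS prednK // (leq_ltn_trans _ j1j).
    by rewrite leNgt; apply/negP => /jmin; rewrite leqNgt ltn_predL (leq_ltn_trans _ j1j).
  rewrite -[leLHS]addr0 lerD //; last by rewrite mulr_ge0 ?exprn_ge0 // divr_ge0 // ltW.
  rewrite ler_pdivlMl // -exprS prednK ?(leq_ltn_trans _ j1j) // -powQ.
  by rewrite ge0_ler_powR ?nnegrE ?ltW.
(* Thickening the covering sets makes membership of [pi u] depend on finitely many digits of u, as
   the fan theorem requires. *)
pose V i w := `[< exists2 p, U i p & cabs (csub w p) <= Q ^+ jj i >].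
(* The constant 3 comes from the set and its thickening on both sides, and 2 c0 from the two
   truncations. *)
have Vclose i u v : V i (pi u) -> V i (pi v) ->
    close (toC z) (M (jj i)) ((3 + 2 * c0) * Q ^+ jj i) u v.
  move=> /asboolP[p Up pu] /asboolP[p' Up' pv]; have [_ dQ _] := jjh i.
  have pp' := le_trans (Udd i _ _ Up Up') dQ.
  have puv : normc (toC (pi u) - toC (pi v)) <= 3 * Q ^+ jj i.
    rewrite -toC_csub -cabsE; apply: le_trans (cabs_triangle p _ _) _.
    apply: (@le_trans _ _ (Q ^+ jj i + (Q ^+ jj i + Q ^+ jj i))); last by lra.
    rewrite lerD //; apply: le_trans (cabs_triangle p' _ _) _.
    by rewrite lerD // cabs_subC.
  rewrite /close (_ : _ - _ = (toC (pi u) - toC (pi v)) +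
    ((toC (pi v) - pt (toC z) (M (jj i)) v) - (toC (pi u) - pt (toC z) (M (jj i)) u)));
    last by ring.
  apply: le_trans (le_normcD _ _) _.
  have := le_normcD (toC (pi v) - pt (toC z) (M (jj i)) v)
    (- (toC (pi u) - pt (toC z) (M (jj i)) u)); rewrite normcN.
  by have := pid u (jj i); have := pid v (jj i); lra.
have [n0 n0h] : exists n, forall u, exists2 i, (i <= n)%N & V i (pi u).
  pose P u n := exists2 i, (i <= n)%N & forall v, agree n u v -> V i (pi v).
  have [|||n nh] := @fan_theorem P.
  - move=> u v n /agreeP uv [i il h]; exists i => // w /agreeP vw; apply: h.
    by apply/agreeP => k kn; rewrite uv ?vw.
  - move=> u m n mn [i im h]; exists i; first exact: leq_trans mn.
    by move=> v /agreeP uv; apply: h; apply/agreeP => k km; exact/uv/(leq_trans km).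
  - move=> u; have [i _ Ui] := AU _ (piA u).
    have z01 : 0 <= cabs z < 1 by rewrite cabs_ge0.
    have [n nh] : exists n, cabs z ^+ n < Q ^+ jj i * (1 - cabs z) / 2.
      by apply: exprn_lt => //; rewrite divr_gt0 ?mulr_gt0 ?subr_gt0.
    exists (maxn i n), i; rewrite ?leq_maxl // => v uv.
    apply/asboolP; exists (pi u) => //; rewrite cabsE toC_csub.
    have hn : cabs z ^+ maxn i n / (1 - cabs z) <= Q ^+ jj i / 2.
      rewrite ler_pdivrMr ?subr_gt0 // mulrAC; apply: le_trans (ltW nh).
      by rewrite ler_wiXn2l ?leq_maxr ?cabs_ge0 // ltW.
    rewrite (_ : toC (pi v) - toC (pi u) = (toC (pi v) - pt (toC z) (maxn i n) v)
      - (toC (pi u) - pt (toC z) (maxn i n) u)); last first.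
      by rewrite (eq_pt _ uv); ring.
    apply: le_trans (le_normcD _ _) _; rewrite normcN [leRHS]splitr.
    by rewrite lerD //; apply: le_trans hn; exact: Aset_pt.
  exists n => u; have [i il h] := nh u; exists i => //; apply: h.
  exact/agreeP.
pose J := (\sum_(i < n0.+1) jj i)%N; pose N := M (j1 + J)%N.
pose cl j u v := close (toC z) (M j) ((3 + 2 * c0) * Q ^+ j) u v.
pose heavy j u := (tau ^+ j < avg N (fun v => (cl j u v)%:R))%R.
(* Each word lies in some V i, and is either light there or heavy at scale [jj i]. Averaging will
   give 1 <= 1/4 + 1/4. *)
have pw u : 1 <= \sum_(i < n0.+1) (V i (pi u) && ~~ heavy (jj i) u)%:R +
    \sum_(i < J.+1) (heavy (j1 + i)%N u)%:R :> R.
  have [i i_le Vi] := n0h u; have il : (i < n0.+1)%N by [].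
  case hi : (heavy (jj i) u); last first.
    rewrite -[leLHS]addr0 lerD ?sumr_ge0 // (bigD1 (Ordinal il)) //= Vi hi.
    by rewrite lerDl sumr_ge0.
  have [j1i _ _] := jjh i.
  have ltJ : (jj i - j1 < J.+1)%N.
    by rewrite ltnS /J (bigD1 (Ordinal il)) //= (leq_trans (leq_subr _ _)) ?leq_addr.
  rewrite -[leLHS]add0r lerD ?sumr_ge0 // (bigD1 (Ordinal ltJ)) //=.
  by rewrite subnKC // hi lerDl sumr_ge0.
have := ler_avg N pw; rewrite avg_cst avgD !avg_sum.
have first_le : \sum_(i < n0.+1) avg N (fun u => (V i (pi u) && ~~ heavy (jj i) u)%:R) <= 1 / 4 :> R.
  apply: (@le_trans _ _ (\sum_(i < n0.+1) (tau^-1 * dd i `^ t + e / 2 * 2^-1 ^+ i))).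
    apply: ler_sum => i _; have [_ _ jle] := jjh i; apply: le_trans jle.
    (* One light word u0 in V i bounds the probability of all of V i, since every other word of V i
       is close to u0. *)
    have [[u0 /andP[Vu0 nh]]|nu0] := pselect (exists u, V i (pi u) && ~~ heavy (jj i) u).
      move: nh; rewrite /heavy -leNgt; apply: le_trans; apply: ler_avg => v.
      by rewrite ler_nat /cl; case: (boolP (V i (pi v))) => //= Vv; rewrite Vclose // leq_b1.
    rewrite -[leLHS](_ : avg N (fun=> 0) = _); first by rewrite avg_cst exprn_ge0 ?ltW.
    apply: eq_avg => u; case: (boolP (_ && _)) => // h; case: nu0; by exists u.
  rewrite big_split /= -!mulr_sumr.
  have := @geometric_sum_le R 2^-1 n0.+1 ltac:(lra).
  rewrite (_ : (1 - 2^-1)^-1 = 2); last by field.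
  move=> gle.
  have h1 : e / 2 * \sum_(i < n0.+1) 2^-1 ^+ i <= e / 2 * 2.
    by rewrite ler_wpM2l // divr_ge0 // ltW.
  have h2 : tau^-1 * \sum_(i < n0.+1) dd i `^ t <= tau^-1 * e.
    by rewrite ler_wpM2l // invr_ge0 ltW.
  have e1 : tau^-1 * e = 1 / 8 by rewrite /e; field; rewrite gt_eqF.
  have e2 : e <= 1 / 8 by rewrite /e; lra.
  by rewrite e1 in h2; lra.
have second_le : \sum_(i < J.+1) avg N (fun u => (heavy (j1 + i)%N u)%:R) <= 1 / 4 :> R.
  apply: le_trans j1h.
  apply: (@le_trans _ _ (A * y ^+ j1 * \sum_(i < J.+1) y ^+ i)); last first.
    by rewrite ler_wpM2l ?geometric_sum_le // mulr_ge0 ?exprn_ge0.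
  rewrite mulr_sumr; apply: ler_sum => i _; set j := (j1 + i)%N.
  have MN : (M j <= N)%N by apply: Mmono; rewrite leq_add2l -ltnS.
  apply: le_trans (markov_avg _ _ _) _; rewrite ?exprn_gt0 //.
    by move=> u; apply: avg_ge0.
  rewrite ler_pdivrMr ?exprn_gt0 // -mulrA -exprD -/j -mulrA -exprMn [y * _]mulrC.
  apply: le_trans (Ph j _); last by rewrite (leq_trans j01) ?leq_addr.
  rewrite (avg_stable MN) => [|u v uv].
    by apply: ler_avg => u; rewrite (avg_stable MN) // => v w vw; rewrite /cl /close (eq_pt _ vw).
  by apply: eq_avg => w; rewrite /cl /close (eq_pt _ uv).
by lra.
Qed.
End LowerBound.

(** * The exceptional parameters in one region form a null set *)

Section Pieces.
Variable R : realType.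
Implicit Types (z w : cpx R) (u v : nat -> bool).

(** Pairs are split by their first difference; those agreeing on K digits are all counted, with
    probability 2^(-K). *)
Lemma close_pairs_le K M c z (theta : R) : (K <= M)%N ->
  (forall k, (k < K)%N -> pairs k M c z <= theta) ->
  avg M (fun u => avg M (fun v => (close (toC z) M c u v)%:R)) <=
    K%:R * theta + 2^-1 ^+ K :> R.
Proof.
move=> KM kth.
apply: (@le_trans _ _ (avg M (fun u => \sum_(k < K) avg M (fun v =>
  (fdiff k u v && close (toC z) M c u v)%:R) + 2^-1 ^+ K))).
  apply: ler_avg => u; rewrite -(avg_agree R u KM) -avg_sum -avgD.
  apply: ler_avg => v; case: (close _ _ _ _ _) => /=.
    by under eq_bigr do rewrite andbT; rewrite -agree_split.
  by rewrite addr_ge0 ?sumr_ge0.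
rewrite avgD avg_cst lerD2r avg_sum.
apply: (@le_trans _ _ (\sum_(k < K) theta)); first by apply: ler_sum => k _; exact: kth.
by rewrite sumr_const card_ord mulr_natl.
Qed.

Lemma piece_hnull (q Rr eta t al : R) b : 0 < q < 1 -> 0 <= Rr < 1 -> 0 < eta ->
  0 < t -> 1 / 2 < q `^ t -> 0 < al -> q `^ al < 1 / 2 ->
  hnull al [set z | [/\ region q eta b z, cabs z <= Rr & hnull t (Aset z)]].
Proof.
move=> /andP[q0 q1] /andP[Rr0 Rr1] eta0 t0 qt al0 qal.
pose p := q `^ t; have p0 : 0 < 2 * p by rewrite /p; lra.
(* This choice makes y = 2 / (2 p)^L below 1, where y is the gain per scale in
   [correlation_lower_bound]. *)
have [L' hL'] : exists L, (2 * p)^-1 ^+ L < 1 / 2.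
  apply: exprn_lt => //; rewrite invr_ge0 ltW //= invf_lt1 // /p; lra.
case: L' hL' => [|l hl]; first by rewrite expr0; lra.
set L := l.+1 in hl; pose Q := q ^+ L.
have Q0 : 0 < Q by rewrite exprn_gt0.
have Q1 : Q < 1 by rewrite exprn_ilt1 // ltW.
have [L' hL'] : exists L', Rr ^+ L' < Q by apply: exprn_lt; rewrite ?Rr0.
(* The L' j digits make the truncation error of order Q^j, and the L j more ensure K j <= M j. *)
pose M j := ((L' + L) * j)%N; pose K j := (l * j)%N.
pose c0 := (1 - Rr)^-1; have c00 : 0 < c0 by rewrite invr_gt0 subr_gt0.
pose c := 3 + 2 * c0; have c_gt0 : 0 < c by rewrite /c; lra.
have [C C0 transC] := @transversality R eta eta0.
pose a := 2 * q `^ al; have qal0 : 0 < q `^ al by rewrite powR_gt0.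
have a0 : 0 <= a by rewrite /a; lra.
have a1 : a < 1 by rewrite /a; lra.
pose theta j : R := 2^-1 ^+ (L * j).
pose Bad j := [set z | region q eta b z /\
  exists2 k, (k < K j)%N & theta j < pairs k (M j) (c * Q ^+ j) z].
have Cc0 : 0 < C * c by rewrite mulr_gt0.
have KM j : (K j <= M j)%N.
  by rewrite leq_mul2r (leq_trans (leqnSn l) (leq_addl L' L)) orbT.
apply: (@hnull_limsup _ al ((C * c) `^ al / (1 - a)) a Bad) => //.
- by rewrite divr_ge0 ?powR_ge0 // subr_ge0 ltW.
- by rewrite a0.
- move=> d d0; have [j0 hj0] : exists j, q ^+ j < d / (C * c).
    by apply: exprn_lt; rewrite ?divr_gt0 // (ltW q0).
  exists j0 => j j0j.
  (* The first difference is indexed downwards from K j - 1, so that n = L j - k = j + i + 1 grows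
     with i and the costs form a geometric series. *)
  pose B i := [set z | (i < K j)%N /\ region q eta b z /\
    theta j < pairs (K j - i.+1) (M j) (c * Q ^+ j) z].
  apply: (@hcov_sub _ al d d _ ((C * c) `^ al / (1 - a) * a ^+ j) _ (\bigcup_i B i)) => //.
    move=> z [rz [k kK kth]]; exists (K j - k.+1)%N => //; split.
      by rewrite ltn_subrL (leq_ltn_trans _ kK).
    split => //; rewrite (_ : (K j - (K j - k.+1).+1)%N = k) //.
    by rewrite subnSK // subKn // ltnW.
  apply: (@hcov_bigcup _ al d _ _ (fun i => (C * c) `^ al * a ^+ j * a ^+ i)) => //.
  + exact: ltW.
  + move=> i; have ee0 : 0 <= (C * c) `^ al * a ^+ j * a ^+ i.
      by rewrite !mulr_ge0 ?powR_ge0 ?exprn_ge0.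
    have [iK|Ki] := ltnP i (K j); last first.
      apply: (@hcov_sub _ al d d _ 0 _ set0) => //; last exact: hcov0 (ltW d0).
      by move=> z [+ _]; rewrite ltnNge Ki.
    set k := (K j - i.+1)%N; pose n := (j + i.+1)%N.
    have kn : (L * j = n + k)%N.
      by rewrite /n /k /L mulSn -addnA subnKC.
    have cE : C * (c * Q ^+ j / q ^+ k) = C * c * q ^+ n.
      rewrite /Q -exprM kn exprD; field; rewrite expf_neq0 ?gt_eqF //.
    have kM : (k < M j)%N.
      by apply: leq_trans (KM j); rewrite ltn_subrL (leq_ltn_trans _ iK).
    have := @hcov_pairs R q eta C b q0 eta0 transC k (M j) (c * Q ^+ j) (theta j) al d (B i) kM.
    rewrite cE => h; apply: (hcov_sub (lexx d) _ (@subset_refl _ (B i))); last apply: h => //.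
    * rewrite /theta kn exprD powRM ?exprn_ge0 ?(ltW Cc0) ?(ltW q0) //.
      rewrite -powR_mulrn ?(ltW q0) // powRAC powR_mulrn ?(ltW qal0) //.
      rewrite [leLHS](_ : _ = (C * c) `^ al * a ^+ n); last first.
        by rewrite /a exprMn !exprVn; field; rewrite !expf_neq0.
      rewrite -mulrA -exprD ler_wpM2l ?powR_ge0 // ler_wiXn2l ?(ltW a1) //.
      by rewrite leq_add2l.
    * by rewrite mulr_ge0 ?exprn_ge0 // ltW.
    * by rewrite exprn_gt0.
    * exact: ltW.
    * move: hj0; rewrite ltr_pdivlMr // mulrC => /ltW; apply: le_trans.
      rewrite ler_pM2l // ler_wiXn2l ?(ltW q0) ?(ltW q1) //.
      by rewrite (leq_trans j0j) ?leq_addr.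
    * by move=> z [_ [rz kth]].
  + move=> n; rewrite -mulr_sumr [leRHS]mulrAC.
    by rewrite ler_wpM2l ?geometric_sum_le ?a0 // mulr_ge0 ?powR_ge0 ?exprn_ge0.
(* A parameter bad at no scale beyond j0 has few close pairs at all these scales, so A_lam cannot be
   null at exponent t. *)
- move=> z j0 [rz zR zA]; apply: contrapT => nB.
  have good j k : (j0 <= j)%N -> (k < K j)%N -> pairs k (M j) (c * Q ^+ j) z <= theta j.
    move=> j0j kK; rewrite leNgt; apply/negP => kth; apply: nB; exists j => //.
    by split => //; exists k.
  have zlt1 : cabs z < 1 by apply: le_lt_trans Rr1.
  have pL0 : 0 < (2 * p) ^+ L by rewrite exprn_gt0.
  pose y := 2 / (2 * p) ^+ L.
  apply: (@correlation_lower_bound _ z Q t y L.+1%:R c0 M j0) => //.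
  + by rewrite Q0.
  + by rewrite /y divr_ge0 ?(ltW pL0) //= -exprVn; lra.
  + exact: ltW.
  + by move=> i j ij; rewrite leq_mul2l ij orbT.
  + move=> j; rewrite mulrC ler_pM ?invr_ge0 ?subr_ge0 ?exprn_ge0 ?cabs_ge0 ?(ltW zlt1) //.
      by rewrite lef_pV2 ?posrE ?subr_gt0 // lerD2l lerN2.
    apply: (@le_trans _ _ (Rr ^+ M j)); first by rewrite lerXn2r ?nnegrE ?cabs_ge0.
    apply: (@le_trans _ _ (Rr ^+ (L' * j))).
      by rewrite ler_wiXn2l ?(ltW Rr1) // leq_mul2r leq_addr orbT.
    by rewrite exprM lerXn2r ?nnegrE ?(ltW Q0) ?(ltW hL') ?exprn_ge0.
  + move=> j j0j.
    have sE : Q `^ t * y = 2^-1 ^+ l.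
      rewrite /Q -powR_mulrn ?(ltW q0) // powRAC -/p powR_mulrn ?powR_ge0 //.
      have pN0 : p != 0 by rewrite gt_eqF // powR_gt0.
      rewrite /y exprMn /L [2 ^+ _]exprS exprVn; field.
      by rewrite !expf_neq0.
    rewrite sE -[2^-1 ^+ l ^+ j]exprM -/(K j).
    apply: le_trans (close_pairs_le (KM j) (fun k kK => good j k j0j kK)) _.
    (* The bound l j 2^(-L j) is at most L 2^(-l j), because j <= 2^j and L = l + 1. *)
    rewrite -[L.+1%:R]natr1 mulrDl mul1r lerD2r /theta /L mulSn exprD mulrA.
    rewrite ler_wpM2r ?exprn_ge0 // exprVn ler_pdivrMr ?exprn_gt0 //.
    rewrite -natrX -natrM ler_nat /K leq_mul // ltnW // ltn_expl //.
Qed.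

End Pieces.

(** * Upper bounds, the countable decomposition, and passage to area measure *)

Section Assembly.
Variable R : realType.
Implicit Types (z w : cpx R) (E : set (cpx R)).

(** Covering by K 2^n balls of radius A x^n costs at most K (2 A)^s (2 x^s)^n, which tends to 0. *)
Lemma hnull_geometric (s A x : R) (K : nat) E : 0 < s -> 0 <= A -> 0 < x < 1 ->
  x `^ s < 1 / 2 ->
  (forall n, exists2 pts : seq (cpx R), (size pts <= K * 2 ^ n)%N &
     forall z, E z -> exists2 p, p \in pts & cabs (csub p z) <= A * x ^+ n) ->
  hnull s E.
Proof.
move=> s0 A0 /andP[x0 x1] xs Epts d e d0 e0.
have xs0 : 0 <= x `^ s := powR_ge0 _ _.
pose B := K%:R * (2 * A) `^ s; have B0 : 0 <= B by rewrite mulr_ge0 ?powR_ge0.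
have [n1 hn1] : exists n, x ^+ n < d / (2 * A + 1).
  by apply: exprn_lt; rewrite ?(ltW x0) //= divr_gt0 ?ltr_wpDl ?mulr_ge0.
have [n2 hn2] : exists n, (2 * x `^ s) ^+ n < e / (B + 1).
  by apply: exprn_lt; [lra|rewrite divr_gt0 ?ltr_wpDl].
pose n := maxn n1 n2; have [pts szpts ptsE] := Epts n.
have D0 : 0 <= 2 * A * x ^+ n by rewrite !mulr_ge0 ?exprn_ge0 // ltW.
apply: (@hcov_sub _ s d d e ((size pts)%:R * (2 * A * x ^+ n) `^ s) _ E) => //.
  apply: (@le_trans _ _ (B * (2 * x `^ s) ^+ n)).
    rewrite powRM ?mulr_ge0 ?exprn_ge0 ?(ltW x0) //.
    rewrite -powR_mulrn ?(ltW x0) // powRAC powR_mulrn // exprMn.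
    rewrite [leRHS](_ : _ = (K%:R * 2 ^+ n) * ((2 * A) `^ s * x `^ s ^+ n)).
      rewrite ler_wpM2r ?mulr_ge0 ?powR_ge0 ?exprn_ge0 //.
      by rewrite -natrX -natrM ler_nat.
    by rewrite /B; ring.
  move: hn2; rewrite ltr_pdivlMr ?ltr_wpDl // mulrC => /ltW; apply: le_trans.
  have xs2 : 0 <= 2 * x `^ s by lra.
  apply: ler_pM => //; [by rewrite exprn_ge0|by rewrite lerDl|].
  by rewrite ler_wiXn2l ?leq_maxr //; lra.
apply: hcov_finite => //.
- rewrite D0 /=; move: hn1; rewrite ltr_pdivlMr ?ltr_wpDl ?mulr_ge0 // mulrC => /ltW.
  apply: le_trans; apply: ler_pM; rewrite ?exprn_ge0 ?(ltW x0) ?mulr_ge0 ?lerDl //.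
  by rewrite ler_wiXn2l ?(ltW x0) ?(ltW x1) ?leq_maxl.
- move=> z /ptsE[p ppts pz]; exists p => //.
  by rewrite (_ : _ / 2 = A * x ^+ n) //; field.
- move=> p z w; rewrite (_ : _ / 2 = A * x ^+ n); last by field.
  move=> pz pw; apply: le_trans (cabs_triangle p _ _) _.
  rewrite (_ : 2 * A * x ^+ n = A * x ^+ n + A * x ^+ n); last by ring.
  by rewrite lerD // cabs_subC.
Qed.

Lemma powR_lt1 (x r : R) : 0 <= x < 1 -> 0 < r -> x `^ r < 1.
Proof.
move=> /andP[x0 x1] r0; have := @gt0_ltr_powR _ _ r0 x 1; rewrite powR1 /=.
by apply; rewrite ?nnegrE.
Qed.

Lemma hnull_real_segment (s : R) : 1 < s ->
  hnull s [set z : cpx R | z.2 = 0 /\ cabs z <= 1].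
Proof.
move=> s1; have s0 : 0 < s by lra.
apply: (@hnull_geometric _ 1 2^-1 3) => //; first lra.
  rewrite (_ : s = 1 + (s - 1)); last by ring.
  rewrite powRD; last by rewrite invr_eq0 pnatr_eq0 implybT.
  rewrite powRr1; last by lra.
  have := @powR_lt1 2^-1 (s - 1) ltac:(lra) ltac:(lra); lra.
move=> n; pose pts := [seq (-1 + i%:R * 2^-1 ^+ n, 0) : cpx R | i <- iota 0 (2 ^ n.+1).+1].
exists pts; first by rewrite size_map size_iota expnS -addn1 (mulSn 2) addnC leq_add2r expn_gt0.
move=> [x y] /= [-> xn].
have h0 : 0 < 2 ^+ n :> R by rewrite exprn_gt0.
have : `|x| <= 1 by apply: le_trans xn; exact: (ge_normc_Re (toC (x, 0))).
rewrite ler_norml => /andP[x0 x1].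
have X0 : 0 <= (x + 1) * 2 ^+ n by rewrite mulr_ge0 ?(ltW h0) //; lra.
pose i := Num.truncn ((x + 1) * 2 ^+ n).
have /andP[i1 i2] := truncn_itv X0; rewrite -/i in i1 i2.
exists (-1 + i%:R * 2^-1 ^+ n, 0).
  apply/mapP; exists i => //; rewrite mem_iota add0n /= ltnS -(ler_nat R).
  by apply: le_trans i1 _; rewrite natrX exprS ler_wpM2r ?(ltW h0) //; lra.
rewrite mul1r; apply: le_trans (normc_le_ReIm (toC _)) _.
rewrite /= subrr normr0 addr0 exprVn.
rewrite (_ : -1 + i%:R / 2 ^+ n - x = (i%:R - (x + 1) * 2 ^+ n) / 2 ^+ n); last first.
  by field; rewrite gt_eqF.
rewrite normrM [`|(2 ^+ n)^-1|]ger0_norm ?invr_ge0 ?(ltW h0) // ler_piMl ?invr_ge0 ?(ltW h0) //.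
by move: i2; rewrite -natr1 ler_norml; lra.
Qed.

Lemma hnull_Aset z (t : R) : 0 < cabs z < 1 -> 0 < t -> cabs z `^ t < 1 / 2 ->
  hnull t (Aset z).
Proof.
move=> z01 t0 zt; have /andP[z0 z1] := z01.
apply: (@hnull_geometric t (1 - cabs z)^-1 (cabs z) 1) => //.
  by rewrite invr_ge0 subr_ge0 ltW.
move=> n; pose P (w : n.-tuple bool) := pt (toC z) n (nth true w).
exists [seq (complex.Re (P x), complex.Im (P x)) | x <- enum {: n.-tuple bool}].
  by rewrite size_map -cardE card_tuple card_bool mul1n.
move=> w [u uw]; pose v : n.-tuple bool := [tuple u i | i < n].
exists (complex.Re (P v), complex.Im (P v)); first by rewrite map_f // mem_enum.
rewrite cabs_subC cabsE toC_csub mulrC.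
have -> : toC (complex.Re (P v), complex.Im (P v)) = pt (toC z) n u.
  rewrite (_ : toC _ = P v); last by rewrite /toC /=; case: (P v).
  apply: eq_pt; apply/agreeP => i ltin.
  by have := tnth_mktuple (fun i : 'I_n => u i) (Ordinal ltin); rewrite (tnth_nth true).
exact: Aset_pt.
Qed.

Lemma simdim_lt (x s : R) : 0 < x < 1 -> (ln 2 / - ln x < s) = (x `^ s < 1 / 2).
Proof.
move=> x01; have /andP[x0 x1] := x01; have lx := ln_lt0 x01.
rewrite ltr_pdivrMr ?oppr_gt0 // -[in RHS]ltr_ln ?posrE ?powR_gt0 // ln_powR div1r.
by rewrite lnV ?posrE // mulrN ltrNr.
Qed.

Lemma lt_simdim (x s : R) : 0 < x < 1 -> (s < ln 2 / - ln x) = (1 / 2 < x `^ s).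
Proof.
move=> x01; have /andP[x0 x1] := x01; have lx := ln_lt0 x01.
rewrite ltr_pdivlMr ?oppr_gt0 // -[in RHS]ltr_ln ?posrE ?powR_gt0 // ln_powR div1r.
by rewrite lnV ?posrE // mulrN ltrNl.
Qed.

Lemma hdim_Aset_le z : 0 < cabs z < 1 -> (hdim (Aset z) <= (simdim z)%:E)%E.
Proof.
move=> z01; have /andP[z0 z1] := z01.
have s0 : 0 < simdim z by rewrite divr_gt0 ?oppr_gt0 ?ln_lt0 // ln_gt0 //; lra.
apply/lee_addgt0Pr => e e0; rewrite -EFinD.
have se : 0 < simdim z + e by lra.
apply: hnull_hdim_le; first exact: ltW.
by apply: hnull_Aset => //; rewrite -simdim_lt // ltrDl.
Qed.

Definition exceptional (r Rr : R) : set (cpx R) :=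
  [set lam | Mset lam /\ (r < cabs lam)%R /\ (cabs lam < Rr)%R /\
                      (hdim (Aset lam) < (simdim lam)%:E)%E].

Lemma invsqrt2_sqr (x : R) : 0 <= x -> x < 1 / Num.sqrt 2 -> x ^+ 2 < 1 / 2.
Proof.
move=> x0; rewrite ltr_pdivlMr ?sqrtr_gt0 // => h.
have : (x * Num.sqrt 2) ^+ 2 < 1.
  by rewrite expr_lt1 // mulr_ge0 ?sqrtr_ge0.
by rewrite exprMn sqr_sqrtr //; lra.
Qed.

Lemma hnull0 (s : R) : 0 < s -> hnull s set0.
Proof.
move=> s0 d e d0 e0; apply: (@hcov_sub _ s d d e 0 _ set0) => //; first exact: ltW.
exact: hcov0 (ltW d0).
Qed.

(** The set is cut into countably many pieces for [piece_hnull], indexed by rational q and t, a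
    distance 1/(m+1) from the real axis and a half-plane; real parameters form one more piece. *)
Lemma exceptional_hnull (r Rr s : R) : 0 < r -> r < Rr -> Rr < 1 / Num.sqrt 2 ->
  ln 2 / - ln Rr < s -> hnull s (exceptional r Rr).
Proof.
move=> r0 rR Rsqrt Rs; have Rr0 : 0 < Rr by lra.
have Rr2 := invsqrt2_sqr (ltW Rr0) Rsqrt.
have Rr1 : Rr < 1 by rewrite -(@ltr_pXn2r _ 2) ?nnegrE ?(ltW Rr0) // expr1n; lra.
have Rr01 : 0 < Rr < 1 by rewrite Rr0.
have s0 : 0 < s.
  by apply: le_lt_trans Rs; rewrite divr_ge0 ?oppr_ge0 ?ln_ge0 ?(ltW (ln_lt0 _)) //; lra.
have [Rhalf|Rhalf] := leP Rr (1 / 2).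
  apply: hnull_sub (hnull0 s0) => z [/Mset_cabs zM [_ [zR _]]].
  by exfalso; lra.
have s1 : 1 < s.
  by apply: lt_trans Rs; rewrite lt_simdim // powRr1 // ltW.
have Rsal : Rr `^ s < 1 / 2 by rewrite -simdim_lt.
pose ok (q t : R) := [/\ 0 < q, q < Rr, 0 < t & 1 / 2 < q `^ t].
pose F (i : option (rat * rat * nat * bool)) :=
  if i is Some (q, t, m, b) then
    [set z : cpx R | ok (ratr q) (ratr t) /\
       [/\ region (ratr q) m.+1%:R^-1 b z, cabs z <= Rr & hnull (ratr t) (Aset z)]]
  else [set z : cpx R | z.2 = 0 /\ cabs z <= 1].
apply: (@hnull_sub _ s _ (\bigcup_i F i)); last first.
  apply: hnull_bigcup => // -[[[[q t] m] b]|]; last exact: hnull_real_segment.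
  have [[q0 qR t0 qt]|nok] := pselect (ok (ratr q) (ratr t)); last first.
    by apply: hnull_sub (hnull0 s0) => z [].
  apply: (@hnull_sub _ s _ [set z : cpx R |
    [/\ region (ratr q) m.+1%:R^-1 b z, cabs z <= Rr & hnull (ratr t) (Aset z)]]).
    by move=> z [].
  apply: piece_hnull => //.
  - by rewrite q0 (lt_trans qR).
  - by rewrite (ltW Rr0).
  - apply: le_lt_trans Rsal.
    by rewrite ge0_ler_powR ?nnegrE ?(ltW s0) ?(ltW q0) ?(ltW Rr0) ?(ltW qR).
move=> z [zM [rz [zR zA]]]; have zhalf := Mset_cabs zM.
have [z20|z20] := eqVneq z.2 0.
  by exists None => //; split => //; lra.
have z01 : 0 < cabs z < 1 by apply/andP; split; lra.
have /andP[z0 z1] := z01.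
have [h hE h0] : exists2 h, hdim (Aset z) = h%:E & 0 <= h.
  have := hdim_ge0 (Aset z); case: (hdim (Aset z)) zA => [h||] // _ h0.
  by exists h.
(* First t is taken between the dimension and the similarity dimension, then q below |z| but so near
   that t stays below the similarity dimension at radius q. *)
rewrite hE lte_fin in zA; have [t] := rat_in_itvoo zA.
rewrite in_itv /= => /andP[ht ts]; have t0 : 0 < ratr t :> R by lra.
have zt : 1 / 2 < cabs z `^ ratr t by rewrite -lt_simdim.
have tz : (1 / 2) `^ (ratr t)^-1 < cabs z.
  have := @gt0_ltr_powR _ (ratr t)^-1 _ (1 / 2) (cabs z `^ ratr t).
  rewrite invr_gt0 => /(_ t0); rewrite -powRrM mulfV ?gt_eqF // powRr1 ?(ltW z0) //.
  by apply; rewrite ?nnegrE ?powR_ge0 //; lra.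
have [q] := rat_in_itvoo tz; rewrite in_itv /= => /andP[hq qz].
have q0 : 0 < ratr q :> R by apply: le_lt_trans hq; exact: powR_ge0.
have qt : 1 / 2 < (ratr q : R) `^ ratr t.
  have := @gt0_ltr_powR _ (ratr t : R) t0 ((1 / 2) `^ (ratr t)^-1) (ratr q).
  rewrite -powRrM mulVf ?gt_eqF // powRr1; last by lra.
  by apply; rewrite ?nnegrE ?powR_ge0 ?(ltW q0).
have [m hm] : exists m, m.+1%:R^-1 <= `|z.2|.
  exists (Num.truncn `|z.2|^-1); rewrite invf_ple ?posrE ?normr_gt0 //.
  by have /andP[_ /ltW] := truncn_itv (ltac:(by rewrite invr_ge0) : 0 <= `|z.2|^-1).
exists (Some (q, t, m, 0 < z.2)) => //; split; first by split => //; lra.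
split; [split => //; first exact: ltW|exact: ltW|].
  apply: le_trans (ltW Rr2); rewrite lerXn2r ?nnegrE ?(ltW z0) ?(ltW Rr0) //.
  exact: ltW.
by apply: hdim_lt_hnull => //; rewrite hE lte_fin.
Qed.

Lemma simdim_lt2 (Rr : R) : 0 < Rr -> Rr < 1 / Num.sqrt 2 -> ln 2 / - ln Rr < 2.
Proof.
move=> Rr0 Rsqrt; have Rr2 := invsqrt2_sqr (ltW Rr0) Rsqrt.
have Rr1 : Rr < 1 by rewrite -(@ltr_pXn2r _ 2) ?nnegrE ?(ltW Rr0) // expr1n; lra.
by rewrite simdim_lt ?Rr0 // powR_mulrn // ltW.
Qed.

(** A set with diameter bound d lies in a square of side 2 d about any of its points, of area 4 d^2.
    Intersecting the resulting covers gives the measurable null set that negligibility asks for. *)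
Lemma hnull2_negligible E : hnull 2 E -> (@leb2 R).-negligible E.
Proof.
move=> E2.
pose mu := [the measure _ _ of (@lebesgue_measure R \x @lebesgue_measure R)%E].
have leb2E (A : set (cpx R)) : leb2 A = mu A by [].
have /choice[G Gh] (k : nat) : exists G : set (cpx R),
    [/\ measurable G, (leb2 G <= (4 * 2^-1 ^+ k)%:E)%E & E `<=` G].
  have [U [dd [EU dd0 Udd dde]]] := E2 1 (2^-1 ^+ k) ltr01 ltac:(by rewrite exprn_gt0).
  pose p i : cpx R := xget (0, 0) (U i).
  pose Q i : set (cpx R) := `[(p i).1 - dd i, (p i).1 + dd i]%classic `*`
    `[(p i).2 - dd i, (p i).2 + dd i]%classic.
  have mQ i : measurable (Q i) by apply: measurableX; exact: measurable_itv.
  have leb_itv (x d : R) : 0 <= d ->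
      lebesgue_measure (`[x - d, x + d]%classic : set R) = (2 * d)%:E.
    move=> d0; rewrite lebesgue_measure_itv /= lte_fin.
    case: ifPn => [_|]; first by rewrite -EFinB; congr (_%:E); ring.
    by rewrite -leNgt => h; congr (_%:E); lra.
  have lebQ i : leb2 (Q i) = (4 * dd i `^ 2)%:E.
    have /andP[d0 _] := dd0 i.
    rewrite /leb2 product_measure1E; try exact: measurable_itv.
    transitivity ((2 * dd i)%:E * (2 * dd i)%:E)%E.
      by congr (_ * _)%E; exact: leb_itv.
    by rewrite powR_mulrn // -EFinM; congr (_%:E); ring.
  exists (\bigcup_i Q i); split; first exact: bigcup_measurable.
    rewrite leb2E; apply: (@le_trans _ _ (\sum_(0 <= i <oo) mu (Q i))%E).
      apply: measure_sigma_subadditive; [exact: mQ| |exact: subset_refl].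
      by apply: bigcup_measurable => i _; exact: mQ.
    apply: lime_le; first by apply: is_cvg_nneseries => *; exact: measure_ge0.
    apply: nearW => n; rewrite big_mkord.
    under eq_bigr do rewrite -leb2E lebQ.
    by rewrite sumEFin lee_fin -mulr_sumr ler_wpM2l.
  move=> z /EU[i _ Uz]; exists i => //.
  have Up : U i (p i) by apply: xgetPex; exists z.
  have zp := Udd i _ _ Uz Up.
  have := le_trans (ge_normc_Re (toC (csub z (p i)))) zp.
  have := le_trans (ge_normc_Im (toC (csub z (p i)))) zp.
  rewrite /Q /= !in_itv /= !ler_norml => /andP[h1 h2] /andP[h3 h4].
  by split; apply/andP; split; lra.
exists (\bigcap_k G k); split.
- by apply: bigcapT_measurable => k; have [] := Gh k.
- apply/eqP; rewrite eq_le; apply/andP; split; last by rewrite leb2E measure_ge0.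
  apply/lee_addgt0Pr => e e0; rewrite add0e.
  have [k hk] : exists k, 2^-1 ^+ k < e / 4.
    by apply: exprn_lt; [lra|rewrite divr_gt0].
  have [mG Gk _] := Gh k; apply: (@le_trans _ _ (leb2 (G k))).
    rewrite !leb2E; apply: le_measure; rewrite ?inE //; last by move=> z; exact.
    by apply: bigcapT_measurable => i; have [] := Gh i.
  by apply: le_trans Gk _; rewrite lee_fin; lra.
- by move=> z Ez k _; have [_ _] := Gh k; exact.
Qed.

End Assembly.

Theorem mainTheorem14 (R : realType) :
  {ae @leb2 R, forall lam : cpx R,
      Mset lam -> cabs lam < 1 / Num.sqrt 2 ->
      hdim (Aset lam) = (simdim lam)%:E}
  /\
  (forall r Rr : R, 0 < r -> r < Rr -> Rr < 1 / Num.sqrt 2 ->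
     (hdim [set lam | Mset lam /\ (r < cabs lam)%R /\ (cabs lam < Rr)%R /\
                      (hdim (Aset lam) < (simdim lam)%:E)%E]
        <= (ln 2 / (- ln Rr))%:E)%E
     /\ ln 2 / (- ln Rr) < 2).
Proof.
have sqrt2 : 1 / 2 < 1 / Num.sqrt 2 :> R.
  rewrite !div1r ltf_pV2 ?posrE ?sqrtr_gt0 // -(@ltr_pXn2r _ 2) ?nnegrE ?sqrtr_ge0 //.
  by rewrite sqr_sqrtr //; lra.
have lt1 (x : R) : 0 <= x -> x < 1 / Num.sqrt 2 -> x < 1.
  move=> x0 /(invsqrt2_sqr x0) x2.
  by rewrite -(@ltr_pXn2r _ 2) ?nnegrE // expr1n; lra.
split; last first.
  move=> r Rr r0 rR Rs; have Rr0 : 0 < Rr := lt_trans r0 rR.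
  split; last exact: simdim_lt2.
  have s0 : 0 <= ln 2 / - ln Rr.
    have l2 : 0 <= ln 2 :> R by rewrite ln_ge0 //; lra.
    by rewrite divr_ge0 // oppr_ge0 ln_le0 // ltW // lt1 // ltW.
  apply/lee_addgt0Pr => e e0; rewrite -EFinD; apply: hnull_hdim_le; first lra.
  by apply: exceptional_hnull => //; rewrite ltrDl.
(* Radii tending to 1 / sqrt 2 from below, all above the inner radius 1/4, which itself is below the
   modulus 1/2 where M begins. *)
pose Rn n : R := 1 / Num.sqrt 2 - 2^-1 ^+ n / 4.
have Rn_bounds n : 1 / 4 < Rn n /\ Rn n < 1 / Num.sqrt 2.
  have : 0 < (2^-1 : R) ^+ n by rewrite exprn_gt0.
  have : (2^-1 : R) ^+ n <= 1 by rewrite exprn_ile1; lra.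
  by rewrite /Rn; lra.
apply: hnull2_negligible.
apply: (@hnull_sub _ 2 _ (\bigcup_n exceptional (1 / 4) (Rn n))); last first.
  apply: hnull_bigcup => // n; have [R1 R2] := Rn_bounds n.
  by apply: exceptional_hnull => //; apply: simdim_lt2 => //; lra.
move=> lam nlam; apply: contrapT => nE; apply: nlam => /= lamM lamlt.
have lamhalf := Mset_cabs lamM.
have lam01 : 0 < cabs lam < 1.
  by rewrite lt1 ?cabs_ge0 // andbT; lra.
apply/eqP; rewrite eq_le hdim_Aset_le //= leNgt; apply/negP => hlt.
have [n hn] : exists n, (2^-1 : R) ^+ n < 1 / Num.sqrt 2 - cabs lam.
  by apply: exprn_lt; lra.
have pn : 0 < (2^-1 : R) ^+ n by rewrite exprn_gt0.
by apply: nE; exists n => //; split => //; split; [|split => //]; rewrite /Rn; lra.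
Qed.
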